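(* Let $n\ge1$. For every $p>0$, there exist a metric space $X$, a quasisymmetric homeomorphism $f:[0,1]^n\to X$, and a Borel set $E\subset[0,1]^n$ such that $$\dim_{\mathrm H}f(E)\le p\quad\text{and}\quad\dim_{\mathrm H}([0,1]^n\setminus E)\le n-1+p.$$
   Context: $[0,1]^n$ carries the Euclidean metric and $\dim_{\mathrm H}$ denotes Hausdorff dimension with respect to the relevant metric. A homeomorphism $f:(X_1,d_1)\to(X_2,d_2)$ between metric spaces is quasisymmetric if there is a homeomorphism $\eta:[0,\infty)\to[0,\infty)$ with $$\frac{d_2(f(x),f(a))}{d_2(f(x),f(b))}\le\eta\!\left(\frac{d_1(x,a)}{d_1(x,b)}\right)$$ for all distinct $x,a,b\in X_1$. *)

(* Defs.v *)
From HB Require Import structures.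
From mathcomp Require Import all_boot all_order all_algebra.
From mathcomp Require Import all_classical all_reals all_analysis.
From mathcomp Require Import ring.

Set Implicit Arguments.
Unset Strict Implicit.
Unset Printing Implicit Defensive.

Import Order.TTheory GRing.Theory Num.Theory.
Import numFieldNormedType.Exports.

Local Open Scope classical_set_scope.
Local Open Scope ring_scope.

(* The library's balls on 'rV[R]_n are those of the sup norm; this alias
   carries the Euclidean metric instead. *)
Definition euclidean (R : realType) (n : nat) : Type := 'rV[R]_n.

Definition euclidean_dist (R : realType) (n : nat) (x y : 'rV[R]_n) : R :=
  Num.sqrt (\sum_(i < n) (x 0 i - y 0 i) ^+ 2).

Section EuclideanMetric.
Context {R : realType} {n : nat}.
Implicit Types x y z : 'rV[R]_n.

Let sqr_sum_ge0 (a : 'I_n -> R) : 0 <= \sum_i a i ^+ 2.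
Proof. by apply: sumr_ge0 => i _; exact: sqr_ge0. Qed.

Lemma euclidean_distxx x : euclidean_dist x x = 0.
Proof.
by rewrite /euclidean_dist big1 ?sqrtr0// => i _; rewrite subrr expr0n.
Qed.

Lemma euclidean_dist_eq0 x y : euclidean_dist x y = 0 -> x = y.
Proof.
move/eqP; rewrite sqrtr_eq0 => le0; apply/rowP => i.
have /eqP : \sum_(j < n) (x 0 j - y 0 j) ^+ 2 = 0.
  by apply/eqP; rewrite eq_le le0 sqr_sum_ge0.
rewrite psumr_eq0; last by move=> j _; exact: sqr_ge0.
by move=> /allP /(_ i (mem_index_enum i)); rewrite sqrf_eq0 subr_eq0 => /eqP.
Qed.

Lemma euclidean_dist_sym x y : euclidean_dist x y = euclidean_dist y x.
Proof.
by congr Num.sqrt; apply: eq_bigr => i _; rewrite -opprB sqrrN.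
Qed.

Lemma cauchy_schwarz_sum (a b : 'I_n -> R) :
  (\sum_i a i * b i) ^+ 2 <= (\sum_i a i ^+ 2) * (\sum_i b i ^+ 2).
Proof.
set A := \sum_i a i ^+ 2; set B := \sum_i b i ^+ 2; set C := \sum_i a i * b i.
have : 0 <= \sum_i (B * a i - C * b i) ^+ 2 by exact: sqr_sum_ge0.
have -> : \sum_i (B * a i - C * b i) ^+ 2 = B * (A * B - C ^+ 2).
  under eq_bigr => i _.
    have -> : (B * a i - C * b i) ^+ 2 =
      B ^+ 2 * a i ^+ 2 + (- (B * C *+ 2)) * (a i * b i) + C ^+ 2 * b i ^+ 2.
      by ring.
    over.
  by rewrite !big_split/= -!mulr_sumr -/A -/B -/C; ring.
have [B0|B0] := eqVneq B 0.
  move=> _; suff -> : C = 0 by rewrite expr0n/= B0 mulr0.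
  rewrite /C big1// => i _.
  move/eqP : B0; rewrite psumr_eq0; last by move=> j _; exact: sqr_ge0.
  move=> /allP /(_ i (mem_index_enum i)); rewrite sqrf_eq0 => /eqP ->.
  by rewrite mulr0.
have B1 : 0 < B by rewrite lt_neqAle eq_sym B0/=; exact: sqr_sum_ge0.
by rewrite pmulr_rge0// subr_ge0.
Qed.

Lemma euclidean_dist_triangle y x z :
  euclidean_dist x z <= euclidean_dist x y + euclidean_dist y z.
Proof.
pose a i := x 0 i - y 0 i; pose b i := y 0 i - z 0 i.
rewrite /euclidean_dist -(ler_pXn2r (ltn0Sn 1)) ?nnegrE ?addr_ge0 ?sqrtr_ge0//.
rewrite sqrrD !sqr_sqrtr; try exact: sqr_sum_ge0.
have -> : \sum_i (x 0 i - z 0 i) ^+ 2 =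
    \sum_i a i ^+ 2 + (\sum_i a i * b i) *+ 2 + \sum_i b i ^+ 2.
  rewrite -sumrMnl -!big_split/=; apply: eq_bigr => i _.
  by rewrite /a /b; ring.
rewrite lerD2r lerD2l lerMn2r/= -sqrtrM; last exact: (sqr_sum_ge0 a).
apply: le_trans (ler_norm _) _; rewrite -sqrtr_sqr ler_wsqrtr//.
exact: cauchy_schwarz_sum.
Qed.

HB.instance Definition _ := Choice.on (euclidean R n).
HB.instance Definition _ := @isMetric.Build R (euclidean R n)
  (@euclidean_dist R n) euclidean_distxx euclidean_dist_eq0
  euclidean_dist_sym euclidean_dist_triangle.

End EuclideanMetric.

Section SubspaceMetric.
Context {R : realType} {T : metricType R} (A : set T).

Let sub_dist (x y : A) : R := mdist (set_val x) (set_val y).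

Let sub_dist_ge0 x y : 0 <= sub_dist x y.
Proof. exact: mdist_ge0. Qed.

Let sub_dist_eq0 x y : sub_dist x y = 0 -> x = y.
Proof. by move=> /mdist_positivity /val_inj. Qed.

Let sub_ballE (x : A) (d : R) : ball x d = [set y | sub_dist x y < d].
Proof. by apply/seteqP; split => y; rewrite /ball/= /initial_ball/= ballEmdist. Qed.

HB.instance Definition _ := @PseudoMetric_isMetric.Build R (A : Type)
  sub_dist sub_dist_ge0 sub_dist_eq0 sub_ballE.

End SubspaceMetric.

Definition unit_cube (R : realType) (n : nat) : set (euclidean R n) :=
  [set x | forall i, 0 <= (x : 'rV[R]_n) 0 i <= 1].
Arguments unit_cube : clear implicits.

Definition homeomorphism (T U : topologicalType) (f : T -> U) : Prop :=
  continuous f /\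
  exists g : U -> T, [/\ continuous g, cancel f g & cancel g f].

Definition halfline (R : realType) : set R := `[0, +oo[.
Arguments halfline : clear implicits.

Definition quasisymmetric (R : realType) (X1 X2 : metricType R)
    (f : X1 -> X2) : Prop :=
  homeomorphism f /\
  exists eta : halfline R -> halfline R,
    homeomorphism eta /\
    forall x a b : X1, x != a -> x != b -> a != b ->
    forall t : halfline R, set_val t = mdist x a / mdist x b ->
      mdist (f x) (f a) / mdist (f x) (f b) <= set_val (eta t).

Definition borel_set (T : topologicalType) (A : set T) : Prop := <<s open >> A.

Section HausdorffDimension.
Context {R : realType} {X : metricType R}.
Implicit Types (A : set X) (s delta : R).
Local Open Scope ereal_scope.

(* The supremum is -oo for the empty set. *)
Definition diameter A : \bar R :=
  ereal_sup [set (mdist xy.1 xy.2)%:E | xy in A `*` A].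

(* The empty set is singled out so that it has weight 0 also for s = 0, where
   every nonempty set has weight 1. *)
Definition hausdorff_weight s A : \bar R :=
  if pselect (A = set0) then 0 else diameter A `^ s.

Definition hausdorff_premeasure s delta A : \bar R :=
  ereal_inf [set \sum_(0 <= i <oo) hausdorff_weight s (U i) | U in
    [set U : (set X)^nat | A `<=` \bigcup_i U i /\
                           forall i, diameter (U i) <= delta%:E]].

Definition hausdorff_measure s A : \bar R :=
  ereal_sup [set hausdorff_premeasure s delta A | delta in [set d | (0 < d)%R]].

Definition hausdorff_dim A : \bar R :=
  ereal_inf [set s%:E | s in [set s | (0 <= s)%R /\ hausdorff_measure s A = 0]].

End HausdorffDimension.

(* Main.v *)
(* Subdivide the cube into k^n subcubes and iterate.  A subcube that meets the
   shell near the boundary of its parent is heavy, the others are light.  Let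
   s_m(x) be the product over the first m generations of 1/2 for each heavy and
   of k^-(B+1) for each light subcube around x.  The new metric is the largest
   one with d(x,y) <= s_m(x) whenever |x - y| <= k^-m.  It is comparable to s_m
   because a path crossing a cube has to cross its shell, and the shells of the
   subcubes there, and so on: the Cantor function that varies only on heavy
   intervals gives Lipschitz bump functions of height s_m(x) at scale k^-m.
   Two-sided power bounds for s_m make the identity quasisymmetric.
   E is the set of points having infinitely often a proportion at least p/2 of
   light generations.  For large B the sets of E become so small in the new
   metric that the k^(nm) cubes of generation m are a cheap cover.  Off E the
   light generations eventually have proportion below p/2, and since only
   O(k^(n-1)) of the k^n subcubes are heavy, an exponential moment bound shows
   that there are few such cubes. *)
Require Import Defs.
From HB Require Import structures.
From mathcomp Require Import all_boot all_order all_algebra.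
From mathcomp Require Import all_classical all_reals all_analysis.
From mathcomp Require Import ring lra zify.

Set Implicit Arguments.
Unset Strict Implicit.
Unset Printing Implicit Defensive.

Import Order.TTheory GRing.Theory Num.Theory.
Import numFieldNormedType.Exports.

Local Open Scope classical_set_scope.
Local Open Scope ring_scope.

(** * Heavy points of the line and the Cantor function that varies only on them *)

Section HeavyReals.
Context {R : realType} (k : nat).
Hypothesis k_ge8 : (8 <= k)%N.
Implicit Types (t u : R) (z : int).
Local Notation kR := (k%:R : R).

(** Equivalently, [t] is within k^-(j+1) of the grid k^-j Z: it lies in the closed first or last of
    the k subintervals of a generation-[j] interval. *)
Definition heavy1 (j : nat) t : Prop :=
  exists z, `|t * kR ^+ j - z%:~R| <= kR^-1.

Let kR_ge8 : 8 <= kR. Proof. by rewrite ler_nat. Qed.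
Let kR_gt0 : 0 < kR. Proof. by have := kR_ge8; lra. Qed.
Let kR_neq0 : kR != 0. Proof. by rewrite gt_eqF. Qed.
Let kR_ge1 : 1 <= kR. Proof. by have := kR_ge8; lra. Qed.
Let kRV_gt0 : 0 < kR^-1. Proof. by rewrite invr_gt0. Qed.
Let kRV_le : kR^-1 <= 8^-1.
Proof. by rewrite lef_pV2 ?posrE ?kR_gt0 ?kR_ge8. Qed.

Lemma exprM_exprV_le (l m : nat) : (l < m)%N -> kR ^+ l * kR ^- m <= kR^-1.
Proof.
case: m => // m; rewrite ltnS => lm.
rewrite ler_pdivrMr ?exprn_gt0// exprS mulKf//.
by rewrite ler_weXn2l.
Qed.

(** The point z k^-(j+1), within k^-m of [t], lies on the grid k^-l because l > j, and m > l makes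
    k^-m at most the tolerance k^-(l+1). *)
Lemma heavy1_near_edge (j l m : nat) t z :
  `|t * kR ^+ j - z%:~R / kR| <= kR ^+ j * kR ^- m -> (j < l < m)%N ->
  heavy1 l t.
Proof.
move=> h /andP[jl lm]; exists (z * k%:Z ^+ (l - j.+1)).
have el : kR ^+ l = kR ^+ j * (kR * kR ^+ (l - j.+1)).
  by rewrite -exprS -exprD; congr (_ ^+ _); lia.
have -> : t * kR ^+ l - (z * k%:Z ^+ (l - j.+1))%:~R =
    (t * kR ^+ j - z%:~R / kR) * (kR * kR ^+ (l - j.+1)).
  rewrite el intrM rmorphXn /= -pmulrn mulrBl mulrA; congr (_ - _).
  by rewrite mulrA divfK.
rewrite normrM (ger0_norm (_ : 0 <= kR * _)); last first.
  by rewrite mulr_ge0 ?exprn_ge0 ?ltW.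
apply: le_trans (exprM_exprV_le lm).
by rewrite el [leRHS]mulrAC ler_wpM2r// mulr_ge0 ?exprn_ge0// ltW.
Qed.

(* Between a heavy and a light point lies an endpoint of a heavy interval,
   which is a point of all finer grids. *)
Lemma heavy1_shift (j l m : nat) t u :
  `|t - u| <= kR ^- m -> heavy1 j t -> ~ heavy1 j u -> (j < l < m)%N ->
  heavy1 l t /\ heavy1 l u.
Proof.
move=> tu [z tz] hu jlm.
have uz : kR^-1 < `|u * kR ^+ j - z%:~R|.
  by rewrite ltNge; apply/negP => ?; apply: hu; exists z.
have D : `|t * kR ^+ j - u * kR ^+ j| <= kR ^+ j * kR ^- m.
  have kj : 0 <= kR ^+ j by rewrite exprn_ge0// ltW.
  by rewrite -mulrBl normrM (ger0_norm kj) mulrC ler_wpM2l.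
suff [e [et eu]] : exists e : int,
    `|t * kR ^+ j - e%:~R / kR| <= kR ^+ j * kR ^- m /\
    `|u * kR ^+ j - e%:~R / kR| <= kR ^+ j * kR ^- m.
  by split; [exact: heavy1_near_edge et _|exact: heavy1_near_edge eu _].
move: tz uz D; set T := t * _; set U := u * _; set d := _ * _ => tz uz D.
have ez (e : int) : (z * k%:Z + e)%:~R / kR = z%:~R + e%:~R * kR^-1.
  by rewrite intrD intrM -pmulrn mulrDl mulfK.
move: tz uz D; rewrite !ler_norml lter_normr => /andP[t1 t2] uz /andP[D1 D2].
case/orP: uz => uz.
- by exists (z * k%:Z + 1); rewrite ez mul1r !ler_norml; split; lra.
- by exists (z * k%:Z - 1); rewrite ez mulN1r !ler_norml; split; lra.
Qed.

Definition clamp t : R := Num.max (-1) (Num.min 1 t).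

Definition nearest t : int := Num.floor (t + 2^-1).

(* It wraps the heavy interval twice around the circle and collapses the light
   one; the Cantor function below is its semiconjugacy to the doubling map. *)
Definition doubling t : R :=
  2 * (nearest t)%:~R + clamp (kR * (t - (nearest t)%:~R)).

Lemma nearest_bounds t :
  - 2^-1 <= t - (nearest t)%:~R < 2^-1.
Proof. by have := floor_itv (t + 2^-1); rewrite -/(nearest t) intrD; lra. Qed.

Lemma nearest_eq t z : `|t - z%:~R| < 2^-1 -> nearest t = z.
Proof.
rewrite ltr_norml => /andP[h1 h2]; apply: floor_def.
by rewrite intrD; apply/andP; split; lra.
Qed.

Variant clamp_spec t : R -> Prop :=
| ClampLow of t < -1 : clamp_spec t (-1)
| ClampMid of -1 <= t <= 1 : clamp_spec t t
| ClampHigh of 1 < t : clamp_spec t 1.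

Lemma clampP t : clamp_spec t (clamp t).
Proof.
rewrite /clamp; case: (ltP 1 t) => t1.
  by rewrite max_r; [constructor|lra].
by case: (ltP t (-1)) => tN1; constructor => //; rewrite tN1.
Qed.

Lemma clamp_lip t u : `|clamp t - clamp u| <= `|t - u|.
Proof.
have h1 := ler_norm (t - u); have h2 := ler_norm (u - t).
rewrite distrC in h2; rewrite ler_norml.
by case: (clampP t) => ?; case: (clampP u) => ?; lra.
Qed.

Lemma doublingE t z : `|t - z%:~R| < 2^-1 ->
  doubling t = 2 * z%:~R + clamp (kR * (t - z%:~R)).
Proof. by move=> /nearest_eq h; rewrite /doubling h. Qed.

(** With r the offset of [t] from [nearest t], the difference is [clamp (kR * r)] minus 2r; both
    terms have the sign of r and absolute value at most 1. *)
Lemma doubling_le t : `|doubling t - 2 * t| <= 1.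
Proof.
have h := nearest_bounds t; rewrite /doubling; set z := (nearest t)%:~R in h *.
have k8 := kR_ge8; have -> : t = z + (t - z) by ring.
move: h; set r := t - z => /andP[h1 h2]; 
rewrite (_ : z + r - z = r); last by ring.
rewrite ler_norml.
have [] := clampP (kR * r) => hr.
- have : r <= 0 by rewrite leNgt; apply/negP => r0;
    have : 0 < kR * r by [rewrite mulr_gt0]; lra.
  lra.
- have [r0|r0] := leP 0 r.
    have : 8 * r <= kR * r by rewrite ler_wpM2r.
    lra.
  have : kR * r <= 8 * r by rewrite ler_wnM2r// ltW.
  lra.
- have : 0 <= r by rewrite leNgt; apply/negP => r0;
    have : kR * r < 0 by [rewrite pmulr_rlt0]; lra.
  lra.
Qed.

(** Heavy intervals have length 2/k, so two light points at distance at most 1/k share a light gap.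
    There [doubling] is constant, since 2z + 1 = 2(z + 1) - 1 makes the formulas at both ends
    agree. *)
Lemma doubling_light t u : `|t - u| <= kR^-1 ->
  ~ heavy1 0 t -> ~ heavy1 0 u -> doubling t = doubling u.
Proof.
have far v : ~ heavy1 0 v -> kR^-1 < `|v - (nearest v)%:~R|.
  by move=> hv; rewrite ltNge; apply/negP => h; apply: hv; exists (nearest v);
    rewrite expr0 mulr1.
have cl v : ~ heavy1 0 v ->
    v - (nearest v)%:~R < - kR^-1 /\ clamp (kR * (v - (nearest v)%:~R)) = -1 \/
    kR^-1 < v - (nearest v)%:~R /\ clamp (kR * (v - (nearest v)%:~R)) = 1.
  move=> /far; rewrite lter_normr => /orP[h|h].
    right; split=> //; have : 1 < kR * (v - (nearest v)%:~R).
      by rewrite mulrC -ltr_pdivrMr// mul1r.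
    by case: clampP => //; lra.
  left; split; first lra; have : kR * (v - (nearest v)%:~R) < -1.
    by rewrite mulrC -ltr_pdivlMr// mulN1r; lra.
  by case: clampP => //; lra.
rewrite ler_norml => /andP[h1 h2] /cl ht /cl hu; rewrite /doubling.
have := nearest_bounds t; have := nearest_bounds u; have := kRV_le.
move: ht hu; set a := nearest t; set b := nearest u => ht hu v8 bb ba.
have ab1 : a%:~R - b%:~R < 2 :> R by lra.
have ab2 : -2 < a%:~R - b%:~R :> R by lra.
have [ab|[ab|ab]] : a = b \/ a = b + 1 \/ b = a + 1.
  have := ab1; have := ab2; rewrite -!intrB.
  rewrite (ltr_int R (a - b) 2) (ltr_int R (-2) (a - b)).
  by move: (a) (b); clear => x y; lia.
- rewrite ab in ht *; case: ht => -[ht1 ->]; case: hu => -[hu1 ->] //; lra.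
- have abR : a%:~R = b%:~R + 1 :> R by rewrite ab intrD.
  by case: ht => -[ht1 ->]; case: hu => -[hu1 ->] //; lra.
- have abR : b%:~R = a%:~R + 1 :> R by rewrite ab intrD.
  by case: ht => -[ht1 ->]; case: hu => -[hu1 ->] //; lra.
Qed.

(* Nondecreasing in [l], so that the supremum below is a limit. *)
Definition cantor_approx t (l : nat) : R := (iter l doubling t - 1) / 2 ^+ l.

Definition cantor t : R := sup (range (cantor_approx t)).

Lemma cantor_approx_le t l : cantor_approx t l <= t + 1.
Proof.
rewrite /cantor_approx ler_pdivrMr ?exprn_gt0//.
suff : iter l doubling t <= (t + 1) * 2 ^+ l - 1 by lra.
elim: l => [|l IH]; first by rewrite expr0 /=; lra.
rewrite iterS exprS; have := doubling_le (iter l doubling t).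
by rewrite ler_norml; lra.
Qed.

Lemma cantor_has_sup t : has_sup (range (cantor_approx t)).
Proof.
split; first by exists (cantor_approx t 0), 0%N.
by exists (t + 1) => _ [l _ <-]; exact: cantor_approx_le.
Qed.

Lemma cantor_approxS t l :
  cantor_approx t l.+1 = cantor_approx (doubling t) l / 2.
Proof. by rewrite /cantor_approx iterSr exprS invfM [2^-1 * _]mulrC mulrA. Qed.

Lemma cantor_near t : `|cantor t - t| <= 1.
Proof.
have h1 : cantor t <= t + 1.
  apply: ge_sup; first by case: (cantor_has_sup t).
  by move=> _ [l _ <-]; exact: cantor_approx_le.
have h2 : t - 1 <= cantor t.
  apply: (ub_le_sup (proj2 (cantor_has_sup t))); exists 0%N => //.
  by rewrite /cantor_approx /= expr0 divr1.
by rewrite ler_norml; lra.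
Qed.

Lemma cantor_doubling t : cantor t = cantor (doubling t) / 2.
Proof.
apply/eqP; rewrite eq_le; apply/andP; split.
  apply: ge_sup; first by case: (cantor_has_sup t).
  move=> _ [[|l] _ <-].
    (* Term 0 is the only one that is not half a term for [doubling t]; it is controlled by
       [doubling t] >= 2t - 1. *)
    rewrite {1}/cantor_approx /= expr0 divr1.
    have := doubling_le t; have := cantor_near (doubling t).
    have : cantor_approx (doubling t) 0 <= cantor (doubling t).
      by apply: (ub_le_sup (proj2 (cantor_has_sup _))); exists 0%N.
    by rewrite {1}/cantor_approx /= expr0 divr1 !ler_norml; lra.
  rewrite cantor_approxS ler_pM2r ?invr_gt0//.
  by apply: (ub_le_sup (proj2 (cantor_has_sup _))); exists l.
rewrite ler_pdivrMr//; apply: ge_sup; first by case: (cantor_has_sup (doubling t)).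
move=> _ [l _ <-]; rewrite -ler_pdivrMr// -cantor_approxS.
by apply: (ub_le_sup (proj2 (cantor_has_sup _))); exists l.+1.
Qed.

(** On the heavy interval around [z], [doubling] is the map t -> kt - (k - 2)z, with slope k and
    integer translation, so it lowers the generation by one. *)
Lemma heavy1_doubling j t z : `|t - z%:~R| <= kR^-1 ->
  heavy1 j (doubling t) -> heavy1 j.+1 t.
Proof.
move=> tz [y]; rewrite (@doublingE _ z); last first.
  by apply: le_lt_trans tz _; have := kRV_le; lra.
have -> : clamp (kR * (t - z%:~R)) = kR * (t - z%:~R).
  have : `|kR * (t - z%:~R)| <= 1.
    by rewrite normrM (gtr0_norm kR_gt0) mulrC -ler_pdivlMr// mul1r.
  by rewrite ler_norml; case: clampP; lra.
move=> h; exists (y + (k%:Z - 2) * z * k%:Z ^+ j); apply: le_trans h.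
rewrite le_eqVlt; apply/orP; left; apply/eqP; congr `|_|.
rewrite intrD !intrM intrB rmorphXn /= -pmulrn exprS; ring.
Qed.

(** Induction on [l]. Two points light at generation 0 are identified by [doubling]. Otherwise
    [doubling] stretches their distance by at most k, and [cantor_doubling] halves the increment of
    the images. The 3 is the initial distance 1 plus an error 1 of [cantor] at each point. *)
Lemma cantor_increment l t u : `|t - u| <= kR ^- l -> cantor t != cantor u ->
  `|cantor t - cantor u| <= 3 / 2 ^+ l /\
  forall j, (j < l)%N -> heavy1 j t \/ heavy1 j u.
Proof.
elim: l t u => [|l IH] t u tu ctu.
  split=> //; move: tu; rewrite !expr0 !invr1 mulr1.
  have := cantor_near t; have := cantor_near u; rewrite !ler_norml; lra.
have k1 : kR ^- l.+1 <= kR^-1.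
  by rewrite lef_pV2 ?posrE ?exprn_gt0// exprS ler_peMr ?exprn_ege1// ltW.
have cd : cantor (doubling t) != cantor (doubling u).
  by apply: contra_neq ctu => e; rewrite cantor_doubling e -cantor_doubling.
wlog [z tz] : t u tu ctu cd / heavy1 0 t.
  move=> W; have [|ht] := pselect (heavy1 0 t); first exact: W.
  have [hu|hu] := pselect (heavy1 0 u).
    have [||||h1 h2] := W u t; rewrite 1?distrC 1?eq_sym//.
    by split => // j /h2[]; [right|left].
  by case/eqP: cd; rewrite (doubling_light _ ht hu)// (le_trans tu).
rewrite expr0 mulr1 in tz.
(* As 2/k < 1/2, the integer [z] is nearest to [u] as well, so [doubling] uses the same formula at
   both points. *)
have uz : `|u - z%:~R| <= kR^-1 + kR^-1.
  have -> : u - z%:~R = (u - t) + (t - z%:~R) by ring.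
  by rewrite (le_trans (ler_normD _ _))// lerD// distrC (le_trans tu).
have duv : `|doubling t - doubling u| <= kR ^- l.
  rewrite !(@doublingE _ z); try by have := kRV_le; have := kRV_gt0; lra.
  rewrite [X in `|X|](_ : _ = clamp (kR * (t - z%:~R)) -
    clamp (kR * (u - z%:~R))); last by ring.
  apply: le_trans (clamp_lip _ _) _; rewrite -mulrBr.
  rewrite [X in _ * X](_ : _ = t - u); last by ring.
  rewrite normrM (gtr0_norm kR_gt0) mulrC -ler_pdivlMr//.
  by rewrite -invfM -exprSr.
have [h1 h2] := IH _ _ duv cd; split.
  rewrite cantor_doubling (cantor_doubling u) -mulrBl normrM exprS invfM mulrCA.
  by rewrite (gtr0_norm (_ : 0 < 2^-1)) ?invr_gt0// mulrC ler_pM2l ?invr_gt0.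
case=> [_|j]; first by left; exists z; rewrite expr0 mulr1.
rewrite ltnS => jl.
(* If [u] is light at generation 0, all generations in between are heavy by [heavy1_shift]; if it is
   heavy, heaviness of the images pulls back. *)
have [[y uy]|hu] := pselect (heavy1 0 u); last first.
  have ht : heavy1 0 t by exists z; rewrite expr0 mulr1.
  have jl1 : (0 < j.+1 < l.+1)%N by rewrite ltnS.
  by left; have [] := heavy1_shift tu ht hu jl1.
rewrite expr0 mulr1 in uy.
case: (h2 j jl) => h.
  by left; exact: heavy1_doubling tz h.
by right; exact: heavy1_doubling uy h.
Qed.

End HeavyReals.

(** * Sizes of cubes and their comparison at nearby points *)

Section Sizes.
Context {R : realType} (n k B : nat).
Hypothesis k_ge8 : (8 <= k)%N.
Local Notation kR := (k%:R : R).
Local Notation cube := (unit_cube R n).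
Implicit Types (x y : cube).

Let kR_ge8 : 8 <= kR. Proof. by rewrite ler_nat. Qed.
Let kR_gt0 : 0 < kR. Proof. by have := kR_ge8; lra. Qed.
Let kR_ge1 : 1 <= kR. Proof. by have := kR_ge8; lra. Qed.

Definition coord x (i : 'I_n) : R := (set_val x : 'rV[R]_n) 0 i.

Lemma coord_itv x i : 0 <= coord x i <= 1.
Proof. exact: (set_valP x). Qed.

Lemma coord_inj x y : coord x =1 coord y -> x = y.
Proof. by move=> h; apply: val_inj; apply/rowP => i; exact: h. Qed.

Definition close (m : nat) x y : Prop :=
  forall i, `|coord x i - coord y i| <= kR ^- m.

Lemma close_sym m x y : close m x y -> close m y x.
Proof. by move=> h i; rewrite distrC. Qed.

Lemma close0 x y : close 0 x y.
Proof.
move=> i; have := coord_itv x i; have := coord_itv y i.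
by rewrite expr0 invr1 ler_norml; lra.
Qed.

Lemma close_le l m x y : (l <= m)%N -> close m x y -> close l x y.
Proof.
move=> lm h i; apply: le_trans (h i) _.
by rewrite lef_pV2 ?posrE ?exprn_gt0// ler_weXn2l.
Qed.

Definition heavy (j : nat) x : bool := `[< exists i, heavy1 k j (coord x i) >].

Lemma heavy_shift (j l m : nat) x y : close m x y ->
  heavy j x != heavy j y -> (j < l < m)%N -> heavy l x /\ heavy l y.
Proof.
move=> xy; wlog [hx hy] : x y xy / heavy j x /\ ~~ heavy j y.
  move=> W h jlm; case: (boolP (heavy j x)) => hx; case: (boolP (heavy j y)) => hy.
  - by rewrite hx hy in h.
  - exact: (W x y).
  - by rewrite and_comm; apply: (W y x) => //; [exact: close_sym|rewrite eq_sym].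
  - by rewrite (negbTE hx) (negbTE hy) in h.
move=> _ jlm; move/asboolP: hx => [i hi]; move/asboolPn: hy => hy.
have hyi : ~ heavy1 k j (coord y i) by move=> h; apply: hy; exists i.
have [h1 h2] := heavy1_shift k_ge8 (xy i) hi hyi jlm.
by split; apply/asboolP; exists i.
Qed.

Definition light_factor : R := kR ^- B.+1.
Local Notation dl := light_factor.

Definition factor (b : bool) : R := if b then 2^-1 else dl.

Lemma light_factor_gt0 : 0 < dl.
Proof. by rewrite invr_gt0 exprn_gt0. Qed.

Lemma light_factor_le : dl <= 2^-1.
Proof.
rewrite lef_pV2 ?posrE ?exprn_gt0// exprS.
have : 1 <= kR ^+ B by rewrite exprn_ege1.
have := kR_ge8; nra.
Qed.

Lemma factor_gt0 b : 0 < factor b.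
Proof. by case: b => /=; rewrite ?light_factor_gt0 ?invr_gt0. Qed.

Lemma factor_le b : factor b <= 2^-1.
Proof. by case: b => //=; rewrite light_factor_le. Qed.

Lemma factor_ge b : dl <= factor b.
Proof. by case: b => //=; rewrite light_factor_le. Qed.

Lemma dlV_gt0 : 0 < dl^-1. Proof. by rewrite invr_gt0 light_factor_gt0. Qed.
Lemma dlV_ge1 : 1 <= dl^-1.
Proof.
by rewrite invf_ge1 ?light_factor_gt0// (le_trans light_factor_le)// invf_le1//; lra.
Qed.

(** The hypothesis leaves room for at most one disagreement below [m], so the products differ in one
    factor, and any two factors have ratio at most [dl^-1]. *)
Lemma prod_factor_le (a b : nat -> bool) m :
  (forall j l, a j != b j -> (j < l < m)%N -> a l = b l) ->
  \prod_(j < m) factor (a j) <= dl^-1 * \prod_(j < m) factor (b j).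
Proof.
elim: m => [|m IH] h; first by rewrite !big_ord0 mulr1 dlV_ge1.
rewrite !big_ord_recr /=; have [e|ne] := eqVneq (a m) (b m).
  rewrite e mulrA ler_wpM2r ?(ltW (factor_gt0 _))//; apply: IH => j l ajbj /andP[jl lm].
  by apply: (h j) => //; rewrite jl ltnS ltnW.
have -> : \prod_(i < m) factor (a i) = \prod_(i < m) factor (b i).
  apply: eq_bigr => j _; congr factor; apply/eqP/negPn/negP => jn.
  by have := h _ m jn; rewrite ltn_ord ltnSn => /(_ isT)/eqP; rewrite (negbTE ne).
rewrite mulrCA ler_wpM2l//; first by apply: prodr_ge0 => i _; exact/ltW/factor_gt0.
rewrite ler_pdivlMl ?light_factor_gt0//.
apply: le_trans (factor_ge _); rewrite ger_pMr ?light_factor_gt0//.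
by apply: le_trans (factor_le _) _; lra.
Qed.

(* The diameter, up to a constant, that the new metric gives to the ball of
   radius [k ^- m] around [x]. *)
Definition size_at (m : nat) x : R := \prod_(j < m) factor (heavy j x).

Lemma size_at_gt0 m x : 0 < size_at m x.
Proof. by apply: prodr_gt0 => i _; exact: factor_gt0. Qed.

Lemma size_at0 x : size_at 0 x = 1. Proof. by rewrite /size_at big_ord0. Qed.

Lemma size_atD l m x : size_at (l + m) x <= 2 ^- m * size_at l x.
Proof.
elim: m => [|m IH]; first by rewrite addn0 expr0 invr1 mul1r.
rewrite addnS /size_at big_ord_recr /= exprS invfM -mulrA mulrC.
by rewrite ler_pM ?factor_le ?(ltW (factor_gt0 _))// ltW// size_at_gt0.
Qed.

Lemma size_atD_ge l m x : dl ^+ m * size_at l x <= size_at (l + m) x.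
Proof.
elim: m => [|m IH]; first by rewrite addn0 expr0 mul1r.
rewrite addnS /size_at big_ord_recr /= exprS -mulrA mulrC.
rewrite ler_pM ?factor_ge ?(ltW light_factor_gt0)//.
by rewrite mulr_ge0 ?exprn_ge0 ?(ltW light_factor_gt0)// ltW// size_at_gt0.
Qed.

Lemma size_at_le l m x : (l <= m)%N -> size_at m x <= size_at l x.
Proof.
move=> lm; rewrite -(subnKC lm); apply: le_trans (size_atD _ _ _) _.
by rewrite ger_pMl ?size_at_gt0// invf_le1 ?exprn_gt0// exprn_ege1//; lra.
Qed.

Lemma size_at_close m x y : close m x y -> size_at m x <= dl^-1 * size_at m y.
Proof.
move=> xy; apply: (@prod_factor_le (heavy ^~ x) (heavy ^~ y)) => j l h jlm.
by have [-> ->] := heavy_shift xy h jlm.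
Qed.

(** Since 3 <= k, the points are close one generation earlier; the second [dl^-1] pays for returning
    to generation [m]. *)
Lemma size_at_near m x y : (forall i, `|coord x i - coord y i| < 3 * kR ^- m) ->
  size_at m x <= dl^-1 ^+ 2 * size_at m y.
Proof.
case: m => [_|m xy].
  by rewrite !size_at0 mulr1 exprn_ege1// dlV_ge1.
have /size_at_close : close m x y.
  move=> i; apply: le_trans (ltW (xy i)) _; rewrite exprSr invfM mulrA mulrAC.
  rewrite ler_piMl ?invr_ge0 ?exprn_ge0 ?(ltW kR_gt0)//.
  by rewrite ler_pdivrMr//; have := kR_ge8; lra.
move=> h; apply: le_trans (le_trans (size_at_le _ (leqnSn m)) h) _.
rewrite exprS expr1 -mulrA ler_pM2l ?dlV_gt0// ler_pdivlMl ?light_factor_gt0//.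
by have := size_atD_ge m 1 y; rewrite expr1 addn1.
Qed.

(** If [x] is light at some j >= [M], then [y] is heavy there, and [heavy_shift] makes [x] heavy at
    all later generations below [l]. So [x] differs at most once from the sequence that is heavy
    from [M] on. *)
Lemma size_at_heavy (l M : nat) x y : close l x y -> (M <= l)%N ->
  (forall j, (M <= j < l)%N -> heavy j x || heavy j y) ->
  2 ^- (l - M) * size_at M x <= dl^-1 * size_at l x.
Proof.
move=> xy Ml hh.
have -> : 2 ^- (l - M) * size_at M x =
    \prod_(j < l) factor (if (j < M)%N then heavy j x else true).
  rewrite -(big_mkord xpredT (fun j => factor (if (j < M)%N then heavy j x else true))).
  rewrite (big_cat_nat (leq0n M) Ml)//= mulrC; congr (_ * _).
    by rewrite big_mkord; apply: eq_bigr => i _; rewrite ltn_ord.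
  rewrite (eq_big_nat _ _ (F2 := fun=> 2^-1)) ?prodr_const_nat ?exprVn//.
  by move=> j /andP[Mj _]; rewrite ltnNge Mj.
apply: (@prod_factor_le (fun j => if (j < M)%N then heavy j x else true)
  (heavy ^~ x)) => j p; case: (ltnP j M) => jM; first by rewrite eqxx.
move=> hj /andP[jp pl]; rewrite ltnNge (leq_trans jM (ltnW jp)) /=.
have hjx : ~~ heavy j x by case: (heavy j x) hj.
have hjy : heavy j y.
  by have := hh j; rewrite (negbTE hjx) jM (ltn_trans jp pl) => /(_ isT).
have [] := @heavy_shift j p l x y xy _ _ => //; first by rewrite (negbTE hjx) hjy.
by rewrite jp.
Qed.

End Sizes.

Lemma exprV_lt {R : realType} (b : nat) (e : R) : (1 < b)%N -> 0 < e ->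
  exists m, b%:R ^- m < e.
Proof.
move=> b1 e0; have b0 : 0 < b%:R :> R by rewrite ltr0n ltnW.
have [m hm] : exists m : nat, e^-1 < m%:R.
  by exists (Num.bound e^-1); apply: archi_boundP; rewrite invr_ge0 ltW.
exists m; rewrite invf_plt ?posrE ?exprn_gt0//; apply: lt_le_trans hm _.
by rewrite -natrX ler_nat; exact/ltnW/ltn_expl.
Qed.

(** * The new metric and its lower bound by bump functions *)

Section Metric.
Context {R : realType} (n k B : nat).
Hypothesis k_ge8 : (8 <= k)%N.
Local Notation kR := (k%:R : R).
Local Notation cube := (unit_cube R n).
Local Notation dl := (light_factor (R:=R) k B).
Local Notation size := (@size_at R n k B).
Local Notation close := (@close R n k).
Implicit Types (x y : cube) (u : cube -> R).

Let kR_ge8 : 8 <= kR. Proof. by rewrite ler_nat. Qed.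
Let kR_gt0 : 0 < kR. Proof. by have := kR_ge8; lra. Qed.
Let kR_ge1 : 1 <= kR. Proof. by have := kR_ge8; lra. Qed.
Let dlV_gt0' : 0 < dl^-1. Proof. exact: dlV_gt0. Qed.
Let dlV_ge1' : 1 <= dl^-1. Proof. exact: dlV_ge1. Qed.

(** The dual description of the largest metric bounded by sizes: for any such metric, the distance
    to a fixed point belongs to this set. A lower bound for the supremum then needs only one
    function. *)
Definition size_lipschitz : set (cube -> R) :=
  [set u | forall x y l, close l x y -> `|u x - u y| <= size l x].

Definition size_dist x y : R := sup [set `|u x - u y| | u in size_lipschitz].

Lemma size_lipschitz0 : size_lipschitz (fun=> 0).
Proof. by move=> x y l _; rewrite subrr normr0 ltW// size_at_gt0. Qed.

Lemma size_dist_has_sup x y : has_sup [set `|u x - u y| | u in size_lipschitz].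
Proof.
split; first by exists `|(0 : R) - 0|, (fun=> 0) => //; exact: size_lipschitz0.
by exists (size 0 x) => _ [u hu <-]; apply: hu; exact: close0.
Qed.

Lemma size_dist_le x y l : close l x y -> size_dist x y <= size l x.
Proof.
move=> xy; apply: ge_sup; first by case: (size_dist_has_sup x y).
by move=> _ [u hu <-]; exact: hu.
Qed.

Lemma size_dist_ge x y u : size_lipschitz u -> `|u x - u y| <= size_dist x y.
Proof.
by move=> hu; apply: (ub_le_sup (proj2 (size_dist_has_sup x y))); exists u.
Qed.

Lemma size_dist_ge0 x y : 0 <= size_dist x y.
Proof. exact: le_trans (normr_ge0 _) (size_dist_ge x y size_lipschitz0). Qed.

(** The cap makes the bump constant away from [x], so that it varies only where sizes are comparable
    to the one at [x]. *)
Definition bump (M : nat) x y : R :=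
  Num.min 1 (\sum_i `|cantor k (coord y i * kR ^+ M) - cantor k (coord x i * kR ^+ M)|).

Lemma min1_lip (s t : R) : `|Num.min 1 s - Num.min 1 t| <= `|s - t|.
Proof.
have h1 := ler_norm (s - t); have h2 := ler_norm (t - s).
rewrite distrC in h2; rewrite ler_norml.
by case: (leP 1 s) => ?; case: (leP 1 t) => ?; lra.
Qed.

Lemma bump_itv M x y : 0 <= bump M x y <= 1.
Proof.
rewrite /bump ge_min lexx /= le_min ler01 /= andbT.
by apply: sumr_ge0 => i _.
Qed.

(** The scaled coordinates differ by at least 3 and [cantor] moves each by at most 1, so the [i]-th
    term alone reaches 1. *)
Lemma bump_far M x y i : 3 * kR ^- M <= `|coord x i - coord y i| -> bump M x y = 1.
Proof.
move=> h; rewrite /bump; apply/min_idPl; rewrite (bigD1 i)//=.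
rewrite -[leLHS]addr0 lerD//; last by apply: sumr_ge0.
have := @cantor_near R k k_ge8 (coord x i * kR ^+ M).
have := @cantor_near R k k_ge8 (coord y i * kR ^+ M).
set cx := cantor _ _; set cy := cantor _ _.
have : 3 <= `|coord x i * kR ^+ M - coord y i * kR ^+ M|.
  rewrite -mulrBl normrM (ger0_norm (_ : 0 <= kR ^+ M)) ?exprn_ge0 ?(ltW kR_gt0)//.
  by rewrite -ler_pdivrMr// exprn_gt0.
set tx := coord x i * _; set ty := coord y i * _.
rewrite !ler_norml !ler_normr => /orP[] h1 /andP[h2 h3] /andP[h4 h5]; apply/orP.
  by right; lra.
by left; lra.
Qed.

(** The factor 3(n+1) bounds a sum of [n] Cantor increments. In [bump_lipschitz], three powers of
    [dl^-1] come from passing from [x] to [y], the fourth from [size_at_heavy]. *)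
Definition lower_const : R := (3 * n.+1%:R * dl^-1 ^+ 4)^-1.

Lemma lower_const_gt0 : 0 < lower_const.
Proof. by rewrite invr_gt0 !mulr_gt0// exprn_gt0. Qed.

Lemma lower_const_le : lower_const <= (dl^-1 ^+ 3)^-1.
Proof.
rewrite lef_pV2 ?posrE ?exprn_gt0// ?mulr_gt0 ?exprn_gt0//.
rewrite (exprS _ 3) mulrA ler_peMl ?exprn_ge0 ?(ltW dlV_gt0')//.
rewrite -[1]mulr1 ler_pM//.
have : 1 <= n.+1%:R :> R by rewrite ler1n.
by lra.
Qed.

(** Scaling by k^M turns generation j of a coordinate into generation j - M, where
    [cantor_increment] applies; any coordinate whose Cantor values differ supplies the heaviness. *)
Lemma bump_close (M l : nat) x y z : (M <= l)%N -> close l y z ->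
  bump M x y != bump M x z ->
  `|bump M x y - bump M x z| <= 3 * n.+1%:R * 2 ^- (l - M) /\
  forall j, (M <= j < l)%N -> heavy k j y || heavy k j z.
Proof.
move=> Ml yz ne.
pose cc (w : cube) i := cantor k (coord w i * kR ^+ M).
have sc i : `|coord y i * kR ^+ M - coord z i * kR ^+ M| <= kR ^- (l - M).
  rewrite -mulrBl normrM (ger0_norm (_ : 0 <= kR ^+ M)) ?exprn_ge0 ?(ltW kR_gt0)//.
  rewrite -ler_pdivlMr ?exprn_gt0// -invfM -exprD subnK//.
have inc i : `|cc y i - cc z i| <= 3 / 2 ^+ (l - M).
  have [->|h] := eqVneq (cc y i) (cc z i).
    by rewrite subrr normr0 divr_ge0// exprn_ge0.
  by have [] := cantor_increment k_ge8 (sc i) h.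
split.
  apply: le_trans (min1_lip _ _) _; rewrite -sumrB.
  apply: le_trans (ler_norm_sum _ _ _) _.
  apply: (@le_trans _ _ (\sum_(i < n) (3 / 2 ^+ (l - M)))).
    apply: ler_sum => i _; apply: le_trans (ler_dist_dist _ _) _.
    rewrite [X in `|X|](_ : _ = cc y i - cc z i) ?inc//.
    by rewrite /cc; ring.
  rewrite sumr_const card_ord -[leLHS]mulr_natr -mulrA [leRHS]mulrAC.
  rewrite [leLHS]mulrA ler_wpM2l ?divr_ge0 ?exprn_ge0//.
  by rewrite ler_nat.
have [i ci] : exists i, cc y i != cc z i.
  apply: contrapT => /forallNP h; case/eqP: ne; congr Num.min.
  apply: eq_bigr => i _; have /negP := h i; rewrite negbK => /eqP e.
  by rewrite /cc in e; rewrite e.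
have [_ hh] := cantor_increment k_ge8 (sc i) ci.
move=> j /andP[Mj jl]; have := hh (j - M)%N; rewrite ltn_sub2r ?(leq_ltn_trans Mj)//.
have tr w : heavy1 k (j - M) (coord w i * kR ^+ M) -> heavy k j w.
  move=> [q]; rewrite -mulrA -exprD subnKC// => hq; apply/asboolP.
  by exists i, q.
by case/(_ isT) => /tr ->; rewrite ?orbT.
Qed.

(** For l <= [M] the bound 1 on the bump and a comparison of sizes suffice. For l > [M] the
    increment decays like 2^-(l-M); it is nonzero only if these generations are heavy, and then the
    size decays no faster up to a constant. *)
Lemma bump_lipschitz M x :
  size_lipschitz (fun y => lower_const * size M x * bump M x y).
Proof.
move=> y z l yz; rewrite -mulrBr normrM.
rewrite ger0_norm; last by rewrite mulr_ge0 ?ltW ?lower_const_gt0 ?size_at_gt0.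
have [->|ne] := eqVneq (bump M x y) (bump M x z).
  by rewrite subrr normr0 mulr0 ltW// size_at_gt0.
(* One of [y], [z] lies within 3 k^-M of [x], since otherwise both bumps equal 1. *)
have near (m : nat) : (m <= M)%N -> (m <= l)%N -> size M x <= dl^-1 ^+ 3 * size m y.
  move=> mM ml.
  have [w [wx wy]] : exists w, (forall i, `|coord x i - coord w i| < 3 * kR ^- M) /\
      close l w y.
    have [hy|] := pselect (forall i, `|coord x i - coord y i| < 3 * kR ^- M).
      exists y; split=> // i; rewrite subrr normr0 invr_ge0 exprn_ge0// ltW//.
    have [hz _|] := pselect (forall i, `|coord x i - coord z i| < 3 * kR ^- M).
      by exists z; split=> //; exact: close_sym.
    move=> /existsNP[i /negP]; rewrite -leNgt => /bump_far e1.
    move=> /existsNP[j /negP]; rewrite -leNgt => /bump_far e2.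
    by case/eqP: ne; rewrite e1 e2.
  apply: le_trans (@size_at_near R n k B k_ge8 M x w wx) _.
  rewrite (exprSr _ 2) -mulrA ler_pM2l ?exprn_gt0//.
  apply: le_trans (_ : size m w <= _); first exact: size_at_le.
  by apply: size_at_close => //; exact: close_le ml wy.
have [lM|Ml] := leqP l M.
  apply: (@le_trans _ _ ((dl^-1 ^+ 3)^-1 * (dl^-1 ^+ 3 * size l y) * 1)).
    apply: ler_pM => //.
    - by rewrite mulr_ge0 ?(ltW lower_const_gt0)// ltW// size_at_gt0.
    - apply: ler_pM; rewrite ?lower_const_le ?near ?(ltW lower_const_gt0)//.
      by rewrite ltW// size_at_gt0.
    have := bump_itv M x y; have := bump_itv M x z.
    by rewrite ler_norml; lra.
  by rewrite mulr1 mulKf// gt_eqF// exprn_gt0.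
have [h1 h2] := bump_close (ltnW Ml) yz ne.
have h3 := near M (leqnn _) (ltnW Ml).
have h4 := @size_at_heavy R n k B k_ge8 l M y z yz (ltnW Ml) h2.
apply: (@le_trans _ _ (lower_const * (dl^-1 ^+ 3 * size M y) *
    (3 * n.+1%:R * 2 ^- (l - M)))).
  apply: ler_pM => //; first by rewrite mulr_ge0 ?ltW ?lower_const_gt0 ?size_at_gt0.
  by rewrite ler_pM2l ?lower_const_gt0.
rewrite (_ : _ * _ = lower_const * (3 * n.+1%:R * dl^-1 ^+ 3) *
   (2 ^- (l - M) * size M y)); last by ring.
apply: le_trans (ler_wpM2l _ h4) _.
  by rewrite mulr_ge0 ?(ltW lower_const_gt0)// !mulr_ge0// ?exprn_ge0// ltW.
rewrite (_ : _ * (dl^-1 * size l y) =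
    lower_const * (3 * n.+1%:R * dl^-1 ^+ 4) * size l y); last first.
  by rewrite (exprSr _ 3) -!mulrA.
by rewrite /lower_const mulVf ?mul1r// gt_eqF// !mulr_gt0// exprn_gt0.
Qed.

Lemma size_dist_lower M x y i : 3 * kR ^- M <= `|coord x i - coord y i| ->
  lower_const * size M x <= size_dist x y.
Proof.
move=> h; apply: le_trans (size_dist_ge _ _ (bump_lipschitz M x)).
rewrite (bump_far h) mulr1.
have -> : bump M x x = 0.
  by rewrite /bump big1 ?min_r// => j _; rewrite subrr normr0.
by rewrite mulr0 sub0r normrN ler_norm.
Qed.

Lemma size_distxx x : size_dist x x = 0.
Proof.
rewrite /size_dist (_ : image _ _ = [set 0]) ?sup1//.
apply/seteqP; split => [_ [u _ <-]|_ ->]; first by rewrite /= subrr normr0.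
by exists (fun=> 0); [exact: size_lipschitz0|rewrite subrr normr0].
Qed.

Lemma size_dist_sym x y : size_dist x y = size_dist y x.
Proof.
by congr sup; apply/seteqP; split => _ [u hu <-]; exists u => //; rewrite distrC.
Qed.

Lemma size_dist_triangle y x z : size_dist x z <= size_dist x y + size_dist y z.
Proof.
apply: ge_sup; first by case: (size_dist_has_sup x z).
move=> _ [u hu <-]; apply: le_trans (ler_distD (u y) _ _) _.
by apply: lerD; exact: size_dist_ge.
Qed.

(** Take the generation just before the first at which the points fail to be close; generation 0
    never fails in the unit cube. *)
Lemma separation_scale x y : x != y ->
  exists m, close m x y /\ exists i, kR ^- m.+1 < `|coord x i - coord y i|.
Proof.
move=> xy.
have [i xyi] : exists i, coord x i != coord y i.
  apply: contrapT => /forallNP h; case/eqP: xy; apply: coord_inj => i.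
  by have /negP := h i; rewrite negbK => /eqP.
have ex : exists m, ~~ `[< close m x y >].
  have [m hm] : exists m, kR ^- m < `|coord x i - coord y i|.
    by apply: exprV_lt (ltn_trans (isT : 1 < 7)%N k_ge8) _; rewrite normr_gt0 subr_eq0.
  by exists m; apply/asboolPn => /(_ i); rewrite leNgt hm.
case: (ex_minnP ex) => -[|m] /asboolPn hm mmin; first by case: hm; exact: close0.
exists m; split.
  by apply: contrapT => /asboolPn/mmin; rewrite ltnn.
move/existsNP: hm => [j /negP]; rewrite -ltNge => hj; by exists j.
Qed.

Lemma expr_scale3 m : 3 * kR ^- m.+2 <= kR ^- m.+1.
Proof.
rewrite (exprSr _ m.+1) invfM mulrA mulrAC ler_piMl ?invr_ge0 ?exprn_ge0 ?(ltW kR_gt0)//.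
by rewrite ler_pdivrMr//; have := kR_ge8; lra.
Qed.

Lemma size_dist_lower_scale m x y i : kR ^- m.+1 < `|coord x i - coord y i| ->
  lower_const * size m.+2 x <= size_dist x y.
Proof.
move=> h; apply: (size_dist_lower (i:=i)); apply: le_trans (ltW h).
exact: expr_scale3.
Qed.

Lemma size_dist_eq0 x y : size_dist x y = 0 -> x = y.
Proof.
move=> d0; apply/eqP/negPn/negP => /separation_scale[m [_ [i /size_dist_lower_scale]]].
by rewrite d0 leNgt mulr_gt0 ?lower_const_gt0 ?size_at_gt0.
Qed.

End Metric.

(* The parameters other than [R] and [n] select the metric. *)
Definition crumpled_cube (R : realType) (n k B : nat) (k_ge8 : (8 <= k)%N) : Type :=
  unit_cube R n.

(** * The cube as a metric space under the new metric *)

Section CrumpledCube.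
Context {R : realType} (n k B : nat) (k_ge8 : (8 <= k)%N).
Local Notation crumpled := (@crumpled_cube R n k B k_ge8).

HB.instance Definition _ := Choice.on crumpled.
HB.instance Definition _ := @isMetric.Build R crumpled
  (size_dist k B) (@size_distxx R n k B k_ge8) (@size_dist_eq0 R n k B k_ge8)
  (@size_dist_sym R n k B) (@size_dist_triangle R n k B k_ge8).

Definition crumple (x : unit_cube R n) : crumpled := x.

End CrumpledCube.

(** * Homeomorphisms of the half-line built from two powers *)

Section PowerHomeomorphism.
Context {R : realType}.
Implicit Types (a b c t u : R).

Lemma powR_norm_continuous a : 0 < a -> continuous (fun t => `|t| `^ a).
Proof.
move=> a0 t; have [->|t0] := eqVneq t 0.
  apply/cvgrPdist_lt => e e0; rewrite normr0 powR0 ?gt_eqF//.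
  apply/nbhs_ballP; exists (e `^ a^-1) => [|u]; first by rewrite /= powR_gt0.
  rewrite /ball_ /= !sub0r !normrN => ue; rewrite ger0_norm ?powR_ge0//.
  rewrite -[ltRHS]powRr1 ?(ltW e0)// -(mulVf (lt0r_neq0 a0)) powRrM.
  by apply: gt0_ltr_powR; rewrite ?nnegrE ?powR_ge0.
apply: (@continuous_comp _ _ _ (fun u => `|u|) (fun u => u `^ a)).
  exact: norm_continuous.
apply/differentiable_continuous/derivable1_diffP/derivable_powR.
by rewrite in_itv /= andbT normr_gt0.
Qed.

(** The distortion function: for a <= b, the power [a] governs small ratios and [b] large ones.
    Absolute values make it continuous on the whole line before restriction to the half-line. *)
Definition gauge A C a b t : R :=
  C * Num.max (`|A * t| `^ a) (`|A * t| `^ b).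

Definition gauge_inv A C a b t : R :=
  Num.min (`|C^-1 * t| `^ a^-1) (`|C^-1 * t| `^ b^-1) / A.

Lemma gauge_continuous A C a b : 0 < a -> 0 < b -> continuous (gauge A C a b).
Proof.
move=> a0 b0 t.
apply: (@continuousM R R (fun=> C) _ t); first exact: cst_continuous.
apply: (@continuous_max R R (fun t => `|A * t| `^ a) (fun t => `|A * t| `^ b)).
  by apply: (@continuous_comp _ _ _ ( *%R A) (fun t => `|t| `^ a));
    [exact: mulrl_continuous|exact: powR_norm_continuous].
by apply: (@continuous_comp _ _ _ ( *%R A) (fun t => `|t| `^ b));
  [exact: mulrl_continuous|exact: powR_norm_continuous].
Qed.

Lemma gauge_inv_continuous A C a b : 0 < a -> 0 < b ->
  continuous (gauge_inv A C a b).
Proof.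
rewrite -!(@invr_gt0 _ a) -!(@invr_gt0 _ b).
move=> a0 b0 t.
apply: (@continuousM R R _ (fun=> A^-1) t); last exact: cst_continuous.
apply: (@continuous_min R R (fun t => `|C^-1 * t| `^ a^-1)
  (fun t => `|C^-1 * t| `^ b^-1)).
  by apply: (@continuous_comp _ _ _ ( *%R C^-1) (fun t => `|t| `^ a^-1));
    [exact: mulrl_continuous|exact: powR_norm_continuous].
by apply: (@continuous_comp _ _ _ ( *%R C^-1) (fun t => `|t| `^ b^-1));
  [exact: mulrl_continuous|exact: powR_norm_continuous].
Qed.

Lemma powRK a u : 0 < a -> 0 <= u -> (u `^ a) `^ a^-1 = u.
Proof. by move=> a0 u0; rewrite -powRrM divff ?gt_eqF// powRr1. Qed.

(** The inverse of a maximum of increasing functions is the minimum of their inverses: each inverse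
    power gives at least [u], and the one matching the maximum gives exactly [u]. *)
Lemma max_powRK a b u : 0 < a -> 0 < b -> 0 <= u ->
  Num.min (Num.max (u `^ a) (u `^ b) `^ a^-1)
          (Num.max (u `^ a) (u `^ b) `^ b^-1) = u.
Proof.
move=> a0 b0 u0; have hi c : 0 < c -> Num.max (u `^ a) (u `^ b) >= u `^ c ->
    u <= Num.max (u `^ a) (u `^ b) `^ c^-1.
  move=> c0 h; rewrite -{1}(powRK c0 u0).
  by apply: ge0_ler_powR;
    rewrite ?nnegrE ?invr_ge0 ?(ltW c0) ?powR_ge0// (le_trans _ h) ?powR_ge0.
have ha := hi _ a0; have hb := hi _ b0.
rewrite !le_max !lexx orbT in ha hb; have {}ha := ha isT; have {}hb := hb isT.
apply/eqP; rewrite eq_le le_min ha hb !andbT ge_min.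
by case: (leP (u `^ a) (u `^ b)) => _; rewrite powRK ?lexx ?orbT.
Qed.

Lemma min_powRK a b u : 0 < a -> 0 < b -> 0 <= u ->
  Num.max (Num.min (u `^ a^-1) (u `^ b^-1) `^ a)
          (Num.min (u `^ a^-1) (u `^ b^-1) `^ b) = u.
Proof.
move=> a0 b0 u0; have iK c : 0 < c -> (u `^ c^-1) `^ c = u.
  by move=> c0; rewrite -powRrM mulVf ?gt_eqF// powRr1.
have lo c : 0 < c -> Num.min (u `^ a^-1) (u `^ b^-1) <= u `^ c^-1 ->
    Num.min (u `^ a^-1) (u `^ b^-1) `^ c <= u.
  move=> c0 h; rewrite -[leRHS](iK c c0).
  by apply: ge0_ler_powR; rewrite ?nnegrE ?(ltW c0) ?powR_ge0// le_min !powR_ge0.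
have la := lo _ a0; have lb := lo _ b0.
rewrite !ge_min !lexx orbT in la lb; have {}la := la isT; have {}lb := lb isT.
apply/eqP; rewrite eq_le ge_max la lb /= le_max.
by case: (leP (u `^ a^-1) (u `^ b^-1)) => _; rewrite iK ?lexx ?orbT.
Qed.

Lemma gaugeK A C a b t : 0 < A -> 0 < C -> 0 < a -> 0 < b -> 0 <= t ->
  gauge_inv A C a b (gauge A C a b t) = t.
Proof.
move=> A0 C0 a0 b0 t0; rewrite /gauge_inv /gauge mulKf ?gt_eqF//.
rewrite (ger0_norm (_ : 0 <= A * t)) ?mulr_ge0 ?(ltW A0)//.
rewrite ger0_norm; last by rewrite le_max powR_ge0.
by rewrite max_powRK ?mulr_ge0 ?(ltW A0)// mulrAC divff ?mul1r ?gt_eqF.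
Qed.

Lemma gauge_invK A C a b t : 0 < A -> 0 < C -> 0 < a -> 0 < b -> 0 <= t ->
  gauge A C a b (gauge_inv A C a b t) = t.
Proof.
move=> A0 C0 a0 b0 t0; rewrite /gauge_inv /gauge.
rewrite (ger0_norm (_ : 0 <= C^-1 * t)) ?mulr_ge0 ?invr_ge0 ?(ltW C0)//.
rewrite [A * _]mulrC divfK ?gt_eqF//.
rewrite ger0_norm; last by rewrite le_min !powR_ge0.
by rewrite min_powRK ?mulr_ge0 ?invr_ge0 ?(ltW C0)// mulVKf ?gt_eqF.
Qed.

Lemma gauge_ge0 A C a b t : 0 < C -> 0 <= gauge A C a b t.
Proof. by move=> C0; rewrite mulr_ge0 ?(ltW C0)// le_max powR_ge0. Qed.

Lemma gauge_inv_ge0 A C a b t : 0 < A -> 0 <= gauge_inv A C a b t.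
Proof. by move=> A0; rewrite divr_ge0 ?(ltW A0)// le_min !powR_ge0. Qed.

Lemma halfline_lift (h : R -> R) : (forall t, 0 <= h t) ->
  exists g : halfline R -> halfline R,
    forall t : halfline R, set_val (g t) = h (set_val t).
Proof.
move=> h0; have mem t : h t \in halfline R.
  by apply: mem_set; rewrite /halfline /= in_itv /= andbT.
by exists (fun t : halfline R => SigSub (mem (set_val t))).
Qed.

Lemma halfline_continuous (h : R -> R) (g : halfline R -> halfline R) :
  continuous h -> (forall t : halfline R, set_val (g t) = h (set_val t)) -> continuous g.
Proof.
move=> ch gh; apply: (@continuous_comp_initial _ _ _ set_val).
rewrite (_ : _ \o g = h \o set_val); last by apply/funext => t; exact: gh.
move=> t; apply: continuous_comp; last exact: ch.
exact: initial_continuous.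
Qed.

Lemma gauge_homeomorphism A C a b : 0 < A -> 0 < C -> 0 < a -> 0 < b ->
  exists eta : halfline R -> halfline R, homeomorphism eta /\
    forall t : halfline R, set_val (eta t) = gauge A C a b (set_val t).
Proof.
move=> A0 C0 a0 b0.
have [g gE] := halfline_lift (fun t => @gauge_ge0 A C a b t C0).
have [f fE] := halfline_lift (fun t => @gauge_inv_ge0 A C a b t A0).
have ge0 (t : halfline R) : 0 <= set_val t.
  by have := set_valP t; rewrite /halfline /= in_itv /= andbT.
exists g; split=> //; split.
  by apply: halfline_continuous gE; exact: gauge_continuous.
exists f; split.
- by apply: halfline_continuous fE; exact: gauge_inv_continuous.
- by move=> t; apply: val_inj; rewrite [LHS]fE gE gaugeK.
- by move=> t; apply: val_inj; rewrite [LHS]gE fE gauge_invK.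
Qed.

End PowerHomeomorphism.

(** * Continuity between metric spaces *)

Section MetricContinuous.
Context {R : realType}.

Lemma metric_continuous (T U : metricType R) (f : T -> U) :
  (forall (x : T) (e : R), 0 < e ->
    exists2 d : R, 0 < d & forall y, mdist x y < d -> mdist (f x) (f y) < e) ->
  continuous f.
Proof.
move=> h x; apply/metricType_numDomainType.cvgrPdist_lt => e e0.
have [d d0 hd] := h x e e0; apply/nbhs_ballP; exists d => // y.
by rewrite ballEmdist => /hd.
Qed.

End MetricContinuous.

(** * The identity onto the crumpled cube is quasisymmetric *)

Section Quasisymmetry.
Context {R : realType} (n k B : nat).
Hypothesis k_ge8 : (8 <= k)%N.
Local Notation kR := (k%:R : R).
Local Notation cube := (unit_cube R n).
Local Notation dl := (light_factor (R:=R) k B).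
Local Notation size := (@size_at R n k B).
Local Notation close := (@close R n k).
Local Notation crumple := (@crumple R n k B k_ge8).
Implicit Types (x y : cube).

Let kR_ge8 : 8 <= kR. Proof. by rewrite ler_nat. Qed.
Let kR_gt0 : 0 < kR. Proof. by have := kR_ge8; lra. Qed.
Let kR_ge1 : 1 <= kR. Proof. by have := kR_ge8; lra. Qed.
Let kR_gt1 : 1 < kR. Proof. by have := kR_ge8; lra. Qed.

Lemma mdist_crumple x y : mdist (crumple x) (crumple y) = size_dist k B x y.
Proof. by []. Qed.

Lemma mdist_cubeE x y :
  mdist x y = Num.sqrt (\sum_(i < n) (coord x i - coord y i) ^+ 2).
Proof. by []. Qed.

Lemma coord_le_mdist x y i : `|coord x i - coord y i| <= mdist x y.
Proof.
rewrite mdist_cubeE -sqrtr_sqr ler_wsqrtr// (bigD1 i)//= lerDl.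
by apply: sumr_ge0 => j _; exact: sqr_ge0.
Qed.

Lemma close_mdist m x y : close m x y -> mdist x y <= n%:R * kR ^- m.
Proof.
move=> h; rewrite mdist_cubeE.
have e0 : 0 <= n%:R * kR ^- m by rewrite mulr_ge0 ?invr_ge0 ?exprn_ge0 ?(ltW kR_gt0).
rewrite -(ger0_norm e0) -sqrtr_sqr ler_wsqrtr// exprMn.
apply: (@le_trans _ _ (\sum_(i < n) (kR ^- m) ^+ 2)).
  apply: ler_sum => i _; rewrite -[leLHS]real_normK ?num_real//.
  by rewrite ler_pXn2r ?nnegrE ?invr_ge0 ?exprn_ge0 ?(ltW kR_gt0)//; exact: h.
rewrite sumr_const card_ord -[leLHS]mulr_natl ler_wpM2r ?sqr_ge0//.
by rewrite -natrX ler_nat; case: (n) => // q; rewrite expnS expn1 leq_pmulr.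
Qed.

Lemma crumple_homeomorphism : homeomorphism crumple.
Proof.
split.
  apply: metric_continuous => x e e0.
  have [m hm] := exprV_lt (isT : 1 < 2)%N e0; exists (kR ^- m).
    by rewrite invr_gt0 exprn_gt0.
  move=> y xy; rewrite mdist_crumple; apply: le_lt_trans hm.
  apply: le_trans (size_dist_le B k_ge8 (l:=m) _) _.
    by move=> i; apply: le_trans (coord_le_mdist _ _ _) (ltW xy).
  by have := size_atD B k_ge8 0 m x; rewrite add0n size_at0 mulr1.
exists (fun x => x); split => //.
apply: (@metric_continuous _ (crumpled_cube R n B k_ge8) cube) => x e e0.
have en0 : 0 < e / n.+1%:R by rewrite divr_gt0.
have [m hm] := exprV_lt (ltn_trans (isT : 1 < 7)%N k_ge8) en0.
(* Points that are not close at scale [m] are at least this far apart in the new metric. *)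
exists (lower_const n k B * size m.+2 x).
  by rewrite mulr_gt0 ?lower_const_gt0 ?size_at_gt0.
move=> y; rewrite [mdist _ _]mdist_crumple => xy.
apply: (@le_lt_trans _ _ (n%:R * kR ^- m)).
  apply: close_mdist => i; rewrite leNgt; apply/negP => h.
  have h1 : kR ^- m.+1 < `|coord x i - coord y i|.
    by apply: le_lt_trans h; rewrite lef_pV2 ?posrE ?exprn_gt0// ler_weXn2l.
  by have := size_dist_lower_scale B k_ge8 h1; rewrite leNgt xy.
apply: (@le_lt_trans _ _ (n.+1%:R * kR ^- m)).
  by rewrite ler_wpM2r ?invr_ge0 ?exprn_ge0 ?(ltW kR_gt0)// ler_nat.
by rewrite mulrC -ltr_pdivlMr.
Qed.

Lemma size_ratio (l M : nat) x : (M <= l)%N ->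
  size l x / size M x <= 2 ^- (l - M).
Proof.
move=> Ml; rewrite ler_pdivrMr ?size_at_gt0//.
by have := size_atD B k_ge8 M (l - M) x; rewrite subnKC.
Qed.

Lemma size_ratio_inv (l M : nat) x : (l <= M)%N ->
  size l x / size M x <= (kR ^+ (M - l)) ^+ B.+1.
Proof.
move=> lM; rewrite ler_pdivrMr ?size_at_gt0//.
have := size_atD_ge B k_ge8 l (M - l) x; rewrite subnKC//.
rewrite /light_factor exprVn -exprM mulnC exprM.
by rewrite ler_pdivrMl ?exprn_gt0.
Qed.

(** It turns a halving of the size per generation into a power of the Euclidean scale. *)
Let expo : R := ln 2 / ln kR.

Let expo_gt0 : 0 < expo.
Proof. by rewrite divr_gt0// ln_gt0//; lra. Qed.

Let powR_expo : kR `^ expo = 2.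
Proof.
rewrite /powR gt_eqF// /expo divfK ?lnK ?posrE//.
by rewrite gt_eqF// ln_gt0.
Qed.

Theorem crumple_quasisymmetric : quasisymmetric crumple.
Proof.
split; first exact: crumple_homeomorphism.
(* The distances satisfy |x - a| > k^-(l+1) and |x - b| <= n k^-m, so this multiple of their ratio
   is at least k^(m+2-l): one k for l+1, two for the loss in [size_dist_lower_scale]. *)
have A0 : 0 < n.+1%:R * kR ^+ 3 by rewrite mulr_gt0// exprn_gt0.
have C0 : 0 < (lower_const n k B : R)^-1 by rewrite invr_gt0 lower_const_gt0.
have b0 : 0 < B.+1%:R :> R by rewrite ltr0n.
have [eta [heta etaE]] := gauge_homeomorphism A0 C0 expo_gt0 b0.
exists eta; split=> // x a b xa xb _ t ht; rewrite etaE ht !mdist_crumple.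
have [l [xal [i xai]]] := separation_scale k_ge8 xa.
have [m [xbm [j xbj]]] := separation_scale k_ge8 xb.
have dxa := size_dist_le B k_ge8 xal.
have dxb := size_dist_lower_scale B k_ge8 xbj.
have m2b := close_mdist xbm.
have m1a := lt_le_trans xai (coord_le_mdist x a i).
have xa0 : 0 < mdist x a.
  by apply: lt_trans m1a; rewrite invr_gt0 exprn_gt0.
have xb0 : 0 < mdist x b.
  apply: lt_le_trans (coord_le_mdist x b j); apply: lt_trans xbj.
  by rewrite invr_gt0 exprn_gt0.
have [lc0 s0] : 0 < lower_const n k B :> R /\ 0 < size m.+2 x.
  by rewrite lower_const_gt0 ?size_at_gt0.
apply: (@le_trans _ _ (size l x / (lower_const n k B * size m.+2 x))).
  apply: ler_pM => //.
  - exact: size_dist_ge0.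
  - by rewrite invr_ge0 size_dist_ge0.
  - have lcs : 0 < lower_const n k B * size m.+2 x by rewrite mulr_gt0.
    by rewrite lef_pV2 ?posrE// (lt_le_trans lcs).
set u := n.+1%:R * kR ^+ 3 * (mdist x a / mdist x b).
have u0 : 0 < u by rewrite mulr_gt0// divr_gt0.
have hu : kR ^+ m.+2 <= u * kR ^+ l.
  have -> : u * kR ^+ l = n.+1%:R * kR ^+ 3 * kR ^+ l * mdist x a / mdist x b.
    by rewrite /u; ring.
  rewrite ler_pdivlMr//; apply: le_trans (ler_wpM2l _ m2b) _.
    by rewrite exprn_ge0 ?(ltW kR_gt0).
  apply: le_trans (ler_wpM2l _ (ltW m1a)); last first.
    by rewrite !mulr_ge0 ?exprn_ge0 ?(ltW kR_gt0).
  have -> : n.+1%:R * kR ^+ 3 * kR ^+ l * kR ^- l.+1 = n.+1%:R * kR ^+ 2.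
    rewrite -mulrA -mulrA; congr (_ * _).
    by rewrite mulrA -exprD addSnnS exprD mulfK ?expf_neq0 ?gt_eqF.
  have -> : kR ^+ m.+2 * (n%:R * kR ^- m) = n%:R * kR ^+ 2.
    by rewrite -addn2 addnC exprD mulrCA mulfK ?expf_neq0 ?gt_eqF.
  by rewrite ler_wpM2r ?exprn_ge0 ?(ltW kR_gt0)// ler_nat.
rewrite /gauge -/u invfM mulrCA ler_pM2l//.
rewrite (ger0_norm (ltW u0)) le_max; apply/orP.
(* When [l] is the finer generation, each generation at least halves the size, giving the power
   [expo]; otherwise each costs at most k^(B+1), giving the power B+1. *)
have [ml|lm] := leqP m.+2 l; [left|right].
  apply: le_trans (size_ratio _ ml) _.
  rewrite -exprVn -powR_expo -powRN -powR_mulrn ?powR_ge0// -powRrM mulNr mulrC.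
  rewrite -mulNr powRrM.
  apply: ge0_ler_powR; rewrite ?nnegrE ?powR_ge0 ?(ltW expo_gt0) ?(ltW u0)//.
  rewrite powR_invn ?(ltW kR_gt0)//.
  rewrite -(ler_pM2r (_ : 0 < kR ^+ l)) ?exprn_gt0//; apply: le_trans hu.
  have -> : kR ^+ l = kR ^+ (l - m.+2) * kR ^+ m.+2 by rewrite -exprD subnK.
  by rewrite mulKf// expf_neq0// gt_eqF.
apply: le_trans (size_ratio_inv _ (ltnW lm)) _.
rewrite powR_mulrn ?(ltW u0)// lerXn2r ?nnegrE ?exprn_ge0 ?(ltW u0) ?(ltW kR_gt0)//.
rewrite -(ler_pM2r (_ : 0 < kR ^+ l)) ?exprn_gt0//; apply: le_trans hu.
by rewrite -exprD subnK// ltnW.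
Qed.

End Quasisymmetry.

(** * Criteria for vanishing Hausdorff measure *)

Section HausdorffNull.
Context {R : realType} {X : metricType R}.
Implicit Types (A : set X) (s d e : R).
Local Open Scope ereal_scope.

Lemma hausdorff_weight_ge0 s A : 0 <= hausdorff_weight s A.
Proof. by rewrite /hausdorff_weight; case: pselect => //= _; exact: poweR_ge0. Qed.

Lemma hausdorff_weight0 s : hausdorff_weight s (set0 : set X) = 0.
Proof. by rewrite /hausdorff_weight; case: pselect. Qed.

Lemma diameter_ge0 A : A !=set0 -> 0 <= diameter A.
Proof.
move=> [x Ax]; apply: le_ereal_sup_tmp; exists 0 => //; exists (x, x) => //=.
by rewrite mdistxx.
Qed.

Lemma diameter_le A d : (forall x y, A x -> A y -> (mdist x y <= d)%R) ->
  diameter A <= d%:E.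
Proof.
by move=> h; apply: ge_ereal_sup => _ [[x y] [Ax Ay] <-]; rewrite lee_fin; exact: h.
Qed.

Lemma hausdorff_weight_le s A d : (0 <= s)%R -> (0 <= d)%R -> diameter A <= d%:E ->
  hausdorff_weight s A <= (d `^ s)%:E.
Proof.
move=> s0 d0 Ad; rewrite /hausdorff_weight; case: pselect => [_|/eqP/set0P An0] /=.
  by rewrite lee_fin powR_ge0.
rewrite -poweR_EFin; apply: gt0_ler_poweR => //; rewrite in_itv /= ?leey ?andbT//.
exact: diameter_ge0.
Qed.

Lemma hausdorff_measure_eq0 s A :
  (forall d e, (0 < d)%R -> (0 < e)%R -> hausdorff_premeasure s d A <= e%:E) ->
  hausdorff_measure s A = 0.
Proof.
move=> h; apply/eqP; rewrite eq_le; apply/andP; split.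
  apply: ge_ereal_sup => _ [d d0 <-]; apply/lee_addgt0Pr => e e0.
  by rewrite add0e; exact: h.
apply: le_ereal_sup_tmp; exists (hausdorff_premeasure s 1 A); first by
  exists 1%R => //=; exact: ltr01.
apply: le_ereal_inf_tmp => _ [U _ <-]; apply: nneseries_ge0 => i _ _.
exact: hausdorff_weight_ge0.
Qed.

Lemma hausdorff_dim_le s A : (0 <= s)%R -> hausdorff_measure s A = 0 ->
  hausdorff_dim A <= s%:E.
Proof. by move=> s0 h; apply: ge_ereal_inf; exists s%:E => //; exists s. Qed.

(** Padding by empty sets, of weight 0, turns a finite family into a sequence with the same total
    weight. *)
Definition enum_family (I : finType) (V : I -> set X) (j : nat) : set X :=
  if insub j is Some i then V (enum_val (i : 'I_#|I|)) else set0.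

Lemma esum_enum_family s (I : finType) (V : I -> set X) :
  \esum_(j in [set: nat]) hausdorff_weight s (enum_family V j) =
  \sum_i hausdorff_weight s (V i).
Proof.
rewrite -(eq_esum (a := fun j => if j \in `I_#|I| then
    hausdorff_weight s (enum_family V j) else 0)); last first.
  move=> j _; case: ifPn => // /negP jI.
  rewrite /enum_family insubF ?hausdorff_weight0//.
  by apply/negP => h; apply: jI; rewrite inE.
rewrite -esum_mkcond esum_fset//; last by move=> *; exact: hausdorff_weight_ge0.
rewrite -fsbig_ord (reindex _ (onW_bij _ (@enum_val_bij I))) /=.
apply: eq_bigr => i _.
by rewrite /enum_family valK.
Qed.

(** A Borel-Cantelli argument: for every M the families of generations from M on cover [A], and
    their total weight is the tail of a convergent geometric series. *)
Lemma hausdorff_measure_limsup s A (I : nat -> finType)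
    (V : forall m, I m -> set X) (C : R) (D : nat -> R) : (0 <= C)%R ->
  (forall x, A x -> forall M, exists2 m, (M <= m)%N & exists i, V m i x) ->
  (forall m i, diameter (V m i) <= (D m)%:E) ->
  (forall d, (0 < d)%R -> exists M, forall m, (M <= m)%N -> (D m <= d)%R) ->
  (forall m, \sum_i hausdorff_weight s (V m i) <= (C / 2 ^+ m)%:E) ->
  hausdorff_measure s A = 0.
Proof.
move=> C0 cov diam small sum; apply: hausdorff_measure_eq0 => d e d0 e0.
have [M0 hM0] := small _ d0.
(* Half of [e], because the tail from M on sums to twice its first term. *)
have [M1 hM1] : exists M, (C / 2 ^+ M <= e / 2)%R.
  have [->|Cn0] := eqVneq C 0%R.
    by exists 0%N; rewrite mul0r divr_ge0// ltW.
  have {}C0 : (0 < C)%R by rewrite lt_neqAle eq_sym Cn0.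
  have eC : (0 < e / 2 / C)%R by rewrite !divr_gt0.
  have [M hM] := exprV_lt (isT : 1 < 2)%N eC; exists M.
  by rewrite mulrC -ler_pdivlMr// ltW.
pose M := maxn M0 M1.
pose W (p : nat * nat) := enum_family (V (M + p.1)%N) p.2.
(* A bijection onto pairs lists the sets of all generations from [M] on in a single sequence. *)
have /card_esym/ppcard_eqP[f] := card_nat2.
apply: (@le_trans _ _ (\sum_(0 <= q <oo) hausdorff_weight s (W (f q)))).
  apply: ereal_inf_lbound; exists (W \o f) => //; split.
    move=> x /cov /(_ M)[m Mm [i Vx]].
    exists (f^-1%FUN (m - M, val (enum_rank i))%N) => //=.
    rewrite invK ?inE// /W /= subnKC// /enum_family valK.
    by rewrite enum_rankK.
  move=> q /=; rewrite /W /enum_family; case: insubP => [i _ _|_].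
    apply: le_trans (diam _ _) _; rewrite lee_fin hM0//.
    by rewrite (leq_trans (leq_maxl M0 M1))// leq_addr.
  by apply: diameter_le => ? ? [].
rewrite nneseries_esumT; last by move=> q; exact: hausdorff_weight_ge0.
rewrite -(@reindex_esum _ _ _ setT setT f (fun p => hausdorff_weight s (W p)));
  last exact: bij.
rewrite (_ : setT = setT `*`` (fun=> setT)); last first.
  by apply/seteqP; split => // -[].
rewrite -(@esum_esum _ _ _ setT (fun=> setT)
  (fun i j => hausdorff_weight s (W (i, j)))); last first.
  by move=> *; exact: hausdorff_weight_ge0.
apply: (@le_trans _ _ (\esum_(i in [set: nat]) (e / (2 ^ i.+1)%:R)%:E)).
  apply: le_esum => i _; rewrite [leLHS](esum_enum_family s (V (M + i)%N)).
  apply: le_trans (sum _) _; rewrite lee_fin natrX.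
  apply: (@le_trans _ _ (e / 2 / 2 ^+ i)%R); last by rewrite exprS invfM mulrA.
  rewrite exprD invfM mulrA ler_wpM2r ?invr_ge0 ?exprn_ge0//.
  apply: le_trans hM1; rewrite ler_wpM2l// lef_pV2 ?posrE ?exprn_gt0//.
  by rewrite ler_weXn2l ?leq_maxr//; lra.
rewrite -nneseries_esumT; last by move=> i; rewrite lee_fin divr_ge0// ltW.
by apply: epsilon_trick0; exact: ltW.
Qed.

End HausdorffNull.

(** * Base-k digits *)

Section Digits.
Context {R : realType} (k : nat).
Hypothesis k_ge8 : (8 <= k)%N.
Local Notation kR := (k%:R : R).
Implicit Types (t u : R).

Let kR_ge8 : 8 <= kR. Proof. by rewrite ler_nat. Qed.
Let kR_gt0 : 0 < kR. Proof. by have := kR_ge8; lra. Qed.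

(* Capping keeps [1] in the last subinterval. *)
Definition first_digit t : nat := minn (Num.truncn (kR * t)) k.-1.

Lemma first_digit_lt t : (first_digit t < k)%N.
Proof. by rewrite /first_digit gtn_min prednK ?leqnn ?orbT// (leq_trans _ k_ge8). Qed.

Definition shift t : R := kR * t - (first_digit t)%:R.

Lemma shift_itv t : 0 <= t <= 1 -> 0 <= shift t <= 1.
Proof.
move=> /andP[t0 t1]; have kt0 : 0 <= kR * t by rewrite mulr_ge0// ltW.
have ktk : kR * t <= kR by rewrite ler_piMr// ltW.
have /andP[h1 h2] := truncn_itv kt0.
rewrite /shift /first_digit; case: leqP => h.
  by rewrite -natr1 in h2; lra.
have kp : k.-1%:R = kR - 1 by rewrite -subn1 natrB// (leq_trans _ k_ge8).
have h3 : kR <= (Num.truncn (kR * t))%:R.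
  by rewrite ler_nat; apply: leq_trans h; exact: leqSpred.
by rewrite kp; lra.
Qed.

Lemma iter_shift_itv j t : 0 <= t <= 1 -> 0 <= iter j shift t <= 1.
Proof. by move=> ht; elim: j => //= j; exact: shift_itv. Qed.

Lemma iter_shift_int j t : exists z : int, iter j shift t = t * kR ^+ j - z%:~R.
Proof.
elim: j => [|j [z IH]]; first by exists 0; rewrite expr0 mulr1 subr0.
exists (k%:Z * z + (first_digit (iter j shift t))%:Z).
rewrite iterS {1}/shift {1}IH intrD intrM -!pmulrn exprS; ring.
Qed.

(** With equal digits the same affine maps act on both points, so the [m]-th iterates differ by k^m
    (t - u), yet both lie in [0,1]. *)
Lemma digits_close m t u : 0 <= t <= 1 -> 0 <= u <= 1 ->
  (forall j, (j < m)%N ->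
    first_digit (iter j shift t) = first_digit (iter j shift u)) ->
  `|t - u| <= kR ^- m.
Proof.
move=> t01 u01 h.
have e : iter m shift t - iter m shift u = kR ^+ m * (t - u).
  elim: m h => [|m IH] h; first by rewrite expr0 mul1r.
  rewrite !iterS /shift h// -/shift exprS -mulrA -IH; last first.
    by move=> j jm; apply: h; exact: ltnW.
  by ring.
have : `|kR ^+ m * (t - u)| <= 1.
  have := iter_shift_itv m t01; have := iter_shift_itv m u01.
  by rewrite -e ler_norml; lra.
rewrite normrM ger0_norm ?exprn_ge0 ?(ltW kR_gt0)// => h1.
by rewrite -[leRHS]mulr1 ler_pdivlMl ?exprn_gt0.
Qed.

(** For s the [j]-th iterate, the digit puts ks in [2, k - 2], whereas heaviness would put it within
    1 of a multiple of k. *)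
Lemma light_digit_light j t : 0 <= t <= 1 ->
  let d := first_digit (iter j shift t) in
  (2 <= d)%N -> (d.+2 < k)%N -> ~ heavy1 k j t.
Proof.
move=> t01 d d2 dk [y hy].
have [z hz] := iter_shift_int j t.
have := shift_itv (iter_shift_itv j t01).
rewrite ![shift (iter _ _ _)]/shift -/d hz; set s := t * kR ^+ j - z%:~R => /andP[s1 s2].
have {}hy : `|s - (y - z)%:~R| <= kR^-1.
  by rewrite intrB /s opprB addrA subrK.
have d2R : 2 <= d%:R :> R by rewrite ler_nat.
have dkR : d%:R + 3 <= kR by rewrite -natrD ler_nat addn3.
have hks : `|kR * s - kR * (y - z)%:~R| <= 1.
  by rewrite -mulrBr normrM (gtr0_norm kR_gt0) mulrC -ler_pdivlMr// mul1r.
move: hks; set q := y - z; rewrite ler_norml => /andP[q1 q2].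
have [q0|q0] := leP q 0.
  have : kR * q%:~R <= 0 by rewrite pmulr_rle0// lerz0.
  lra.
have : kR <= kR * q%:~R by rewrite ler_peMr ?(ltW kR_gt0)// ler1z.
lra.
Qed.

End Digits.

(** * Cells of words of digits and the count of light letters *)

Section Cells.
Context {R : realType} (n k : nat).
Hypothesis k_ge8 : (8 <= k)%N.
Local Notation kR := (k%:R : R).
Local Notation cube := (unit_cube R n).
Implicit Types (x y : cube).

Let kR_ge8 : 8 <= kR. Proof. by rewrite ler_nat. Qed.
Let kR_gt0 : 0 < kR. Proof. by have := kR_ge8; lra. Qed.

Definition word (m : nat) : finType := {ffun 'I_m -> {ffun 'I_n -> 'I_k}}.

Definition itinerary m x : word m :=
  [ffun j : 'I_m => [ffun i =>
    Ordinal (first_digit_lt k_ge8 (iter j (shift k) (coord x i)))]].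

Definition cell m (w : word m) : set cube := [set x | itinerary m x = w].

Lemma cell_close m (w : word m) x y : cell w x -> cell w y -> close k m x y.
Proof.
move=> wx wy i; apply: digits_close => //; try exact: coord_itv.
move=> j jm; have : itinerary m x = itinerary m y by rewrite wx wy.
move=> /ffunP/(_ (Ordinal jm)); rewrite !ffunE => /ffunP/(_ i).
by rewrite !ffunE => /(congr1 val).
Qed.

Definition inner_digit (d : 'I_k) : bool := (2 <= d)%N && (d.+2 < k)%N.

Definition light_letter (v : {ffun 'I_n -> 'I_k}) : bool :=
  [forall i, inner_digit (v i)].

Definition word_lightness m (w : word m) : nat := \sum_(j < m) light_letter (w j).

Definition lightness (m : nat) x : nat := \sum_(j < m) ~~ heavy k j x.

(** Only an inequality, as words see digits alone: a point may be light with an outer digit such as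
    1. *)
Lemma word_lightness_le m x : (word_lightness (itinerary m x) <= lightness m x)%N.
Proof.
apply: leq_sum => j _; case: (boolP (light_letter _)) => //= /forallP hl.
suff -> : ~~ heavy k j x by [].
apply/asboolPn => -[i]; have := hl i; rewrite /inner_digit !ffunE /= => /andP[h1 h2].
by apply: light_digit_light => //; exact: coord_itv.
Qed.

Lemma size_at_lightness B m x :
  size_at k B m x <= light_factor k B ^+ lightness m x.
Proof.
rewrite /lightness expr_sum /size_at; apply: ler_prod => j _.
rewrite (ltW (factor_gt0 _ _ _)) //=.
by case: (heavy k j x) => /=; rewrite ?expr0 ?expr1//; lra.
Qed.

Lemma card_outer_digits : \sum_(d < k) (~~ inner_digit d)%:R <= 4 :> R.
Proof.
rewrite -natr_sum ler_nat.
have k0 : (0 < k)%N by exact: leq_trans k_ge8.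
have k1 : (1 < k)%N by exact: leq_trans k_ge8.
have k2 : (k - 1 < k)%N by lia.
have k3 : (k - 2 < k)%N by lia.
pose H := [:: Ordinal k0; Ordinal k1; Ordinal k2; Ordinal k3].
apply: (@leq_trans #|H|); last exact: card_size.
rewrite -sum1_card [leqRHS]big_mkcond /=; apply: leq_sum => d _.
case: (boolP (inner_digit d)) => // hd.
suff -> : d \in H by [].
rewrite !inE -!val_eqE /=; move: hd; rewrite /inner_digit.
by have := ltn_ord d; lia.
Qed.

(** The summand is a product over coordinates, so the sum factors: at most 4 from [i0] and k from
    each other coordinate. *)
Lemma sum_outer_letter (i0 : 'I_n) :
  \sum_(v : {ffun 'I_n -> 'I_k}) (~~ inner_digit (v i0))%:R <= 4 * kR ^+ n.-1.
Proof.
pose F (i : 'I_n) (d : 'I_k) : R := if i == i0 then (~~ inner_digit d)%:R else 1.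
rewrite (eq_bigr (fun v : {ffun 'I_n -> 'I_k} => \prod_i F i (v i))); last first.
  move=> v _; rewrite (bigD1 i0)//= {1}/F eqxx big1 ?mulr1//.
  by move=> i /negbTE ii0; rewrite /F ii0.
rewrite -(bigA_distr_bigA F) (bigD1 i0)//=.
apply: ler_pM => //.
- by apply: sumr_ge0 => d _; rewrite /F eqxx.
- by apply: prodr_ge0 => i _; apply: sumr_ge0 => d _; rewrite /F; case: ifP.
- by rewrite (eq_bigr (fun d => (~~ inner_digit d)%:R)) ?card_outer_digits// => d _;
    rewrite /F eqxx.
rewrite (eq_bigr (fun=> kR)); last first.
  move=> i /negbTE ii0; rewrite (eq_bigr (fun=> 1)); last by move=> d _; rewrite /F ii0.
  by rewrite sumr_const card_ord.
by rewrite prodr_const cardC1 card_ord.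
Qed.

(** A light letter weighs 1/k, and there are at most k^n of them. Any other has an outer digit in
    some coordinate, and a union bound over coordinates counts these. *)
Lemma sum_letter_weight : (0 < n)%N ->
  \sum_(v : {ffun 'I_n -> 'I_k}) kR ^- light_letter v <= (4 * n%:R + 1) * kR ^+ n.-1.
Proof.
move=> n0.
apply: (@le_trans _ _ (\sum_(v : {ffun 'I_n -> 'I_k})
    (\sum_i (~~ inner_digit (v i))%:R + kR^-1))).
  apply: ler_sum => v _; case: (boolP (light_letter v)) => /=.
    by rewrite expr1 lerDr sumr_ge0.
  rewrite negb_forall => /existsP[i hi]; rewrite expr0 invr1 (bigD1 i)//= hi.
  by rewrite -addrA lerDl addr_ge0 ?sumr_ge0// invr_ge0 ltW.
rewrite big_split /= exchange_big /= mulrDl mul1r; apply: lerD.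
  apply: le_trans (ler_sum _ (fun i _ => sum_outer_letter i)) _.
  by rewrite sumr_const card_ord -mulr_natl; lra.
rewrite sumr_const card_ffun !card_ord -[leLHS]mulr_natl natrX.
by rewrite -{1}(prednK n0) exprSr mulfK// gt_eqF.
Qed.

(** An exponential moment of the number of light letters; it factors over the letters. *)
Lemma sum_word_weight m : (0 < n)%N ->
  \sum_(w : word m) kR ^- word_lightness w <= ((4 * n%:R + 1) * kR ^+ n.-1) ^+ m.
Proof.
move=> n0; apply: (@le_trans _ _ ((\sum_(v : {ffun 'I_n -> 'I_k})
    kR ^- light_letter v) ^+ m)); last first.
  have h1 : 0 <= \sum_(v : {ffun 'I_n -> 'I_k}) kR ^- light_letter v.
    by apply: sumr_ge0 => v _; rewrite invr_ge0 exprn_ge0// ltW.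
  have h2 := le_trans h1 (sum_letter_weight n0).
  by rewrite lerXn2r ?nnegrE// sum_letter_weight.
rewrite -[m in leRHS]card_ord -prodr_const.
rewrite (bigA_distr_bigA (fun _ v => kR ^- light_letter v)) /=.
rewrite le_eqVlt; apply/orP; left; apply/eqP; apply: eq_bigr => w _.
by rewrite /word_lightness expr_sum prodfV.
Qed.

End Cells.

(** * The set of often light points and the two dimension estimates *)

Section ExceptionalSet.
Context {R : realType} (n k : nat).
Hypothesis k_ge8 : (8 <= k)%N.
Local Notation kR := (k%:R : R).
Local Notation cube := (unit_cube R n).
Implicit Types (x y : cube) (th : R).

Let kR_ge8 : 8 <= kR. Proof. by rewrite ler_nat. Qed.
Let kR_gt0 : 0 < kR. Proof. by have := kR_ge8; lra. Qed.
Let kR_ge1 : 1 <= kR. Proof. by have := kR_ge8; lra. Qed.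

Definition light_at th (m : nat) : set cube :=
  [set x | th * m%:R <= (lightness k m x)%:R].

Definition often_light th : set cube :=
  [set x | forall M, exists2 m, (M <= m)%N & light_at th m x].

(** Near [t] only the nearest grid integer y could cause heaviness: r <= 1/4 and 1/k <= 1/8 rule out
    all others, and the gap between |T - y| and 1/k rules out y. *)
Lemma heavy1_closed j (t : R) : ~ heavy1 k j t ->
  exists2 r, 0 < r & forall u, `|t - u| < r -> ~ heavy1 k j u.
Proof.
move=> ht; have kj : 0 < kR ^+ j by rewrite exprn_gt0.
set T := t * kR ^+ j; set y := nearest T.
have gap : 0 < `|T - y%:~R| - kR^-1.
  by rewrite subr_gt0 ltNge; apply/negP => h; apply: ht; exists y.
have kV : kR^-1 <= 8^-1 by rewrite lef_pV2 ?posrE.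
pose r := Num.min (`|T - y%:~R| - kR^-1) 4^-1.
have r0 : 0 < r by rewrite lt_min gap; lra.
exists (r / kR ^+ j); first by rewrite divr_gt0.
move=> u tu [z hz]; have {}tu : `|T - u * kR ^+ j| < r.
  by rewrite -mulrBl normrM (gtr0_norm kj) -ltr_pdivlMr.
have zT : `|T - z%:~R| < r + kR^-1.
  have -> : T - z%:~R = (T - u * kR ^+ j) + (u * kR ^+ j - z%:~R) by ring.
  by apply: le_lt_trans (ler_normD _ _) _; rewrite ltr_leD.
have [r1 r2] : r <= `|T - y%:~R| - kR^-1 /\ r <= 4^-1.
  by rewrite !ge_min !lexx orbT.
have yz : y = z by apply: nearest_eq; apply: lt_le_trans zT _; lra.
by move: zT; rewrite -yz; lra.
Qed.

Lemma light_at_open th m : open (light_at th m).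
Proof.
rewrite openE => x; rewrite /light_at /= => hx.
have FF : Filter (nbhs x) by exact: nbhs_filter.
suff : \forall y \near x, forall j : 'I_m, ~~ heavy k j x -> ~~ heavy k j y.
  apply: filterS => y hy; apply: le_trans hx _; rewrite ler_nat.
  apply: leq_sum => j _; have := hy j.
  by do 2 case: (heavy k j _) => //=; move=> /(_ isT).
apply: (filter_forall FF) => j.
case: (boolP (heavy k j x)) => hx'; first exact: nearW.
suff : \forall y \near x, forall i, ~ heavy1 k j (coord y i).
  apply: filterS => y hy _; apply/asboolPn => -[i]; exact: hy.
apply: (filter_forall FF) => i.
have [|r r0 hr] := @heavy1_closed j (coord x i).
  by move=> h; move/asboolPn: hx' => []; exists i.
apply/nbhs_ballP; exists r => // y; rewrite ballEmdist /= => xy.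
by apply: hr; apply: le_lt_trans (coord_le_mdist _ _ _) xy.
Qed.

(** The set is a limsup of open sets, hence a countable intersection of open sets, expressed through
    complements. *)
Lemma often_light_borel th : borel_set (often_light th).
Proof.
have [_ hD hU] := @smallest_sigma_algebra cube setT open.
pose G M := \bigcup_(m in [set m | (M <= m)%N]) light_at th m.
have GM M : <<s open >> (G M).
  apply: sub_sigma_algebra; apply: bigcup_open => m _; exact: light_at_open.
rewrite /borel_set (_ : often_light th = setT `\` \bigcup_M (setT `\` G M)).
  by apply: (hD); apply: hU => M; apply: hD.
apply/seteqP; split => x.
  move=> hx; split=> // -[M _ [_]]; apply.
  by have [m Mm xm] := hx M; exists m.
by move=> [_ hx] M; apply: contrapT => h; apply: hx; exists M.
Qed.

Lemma powR_exprn (a b : R) m : 0 <= a -> (a ^+ m) `^ b = (a `^ b) ^+ m.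
Proof.
move=> a0; elim: m => [|m IH]; first by rewrite !expr0 powR1.
by rewrite !exprS powRM ?exprn_ge0// IH.
Qed.

Lemma sum_weight_le {X : metricType R} (I : finType) (V : I -> set X) s
    (r : I -> R) (b : R) :
  (forall i, (hausdorff_weight s (V i) <= (r i)%:E)%E) -> \sum_i r i <= b ->
  (\sum_i hausdorff_weight s (V i) <= b%:E)%E.
Proof.
move=> h rb; apply: (@le_trans _ _ (\sum_i (r i)%:E)%E); first exact: lee_sum.
by rewrite sumEFin lee_fin.
Qed.

Lemma exprV_small (C : R) : 0 <= C -> forall d, 0 < d ->
  exists M, forall m, (M <= m)%N -> C * kR ^- m <= d.
Proof.
move=> C0 d d0; have dC : 0 < d / (C + 1) by rewrite divr_gt0// ltr_wpDl.
have [M hM] := exprV_lt (leq_trans (isT : 1 < 8)%N k_ge8) dC.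
exists M => m Mm; apply: (@le_trans _ _ ((C + 1) * kR ^- M)).
  apply: ler_pM; rewrite ?lerDl ?invr_ge0 ?exprn_ge0 ?(ltW kR_gt0)//.
  by rewrite lef_pV2 ?posrE ?exprn_gt0// ler_weXn2l.
by rewrite mulrC -ler_pdivlMr ?ltr_wpDl// ltW.
Qed.

(** With be = (B+1)th, a cell meeting [light_at th m] has new diameter at most k^-(be m). The bound
    be >= 1 makes diameters shrink, and be p >= n+1 makes the k^(nm) cells weigh at most k^-m
    together. *)
Lemma hausdorff_crumple_often_light B th (p : R) : 0 < p -> 0 <= th ->
  1 <= B.+1%:R * th -> n.+1%:R <= B.+1%:R * th * p ->
  hausdorff_measure p (crumple B k_ge8 @` often_light th) = 0.
Proof.
move=> p0 th0 b1 b2; set be := B.+1%:R * th in b1 b2.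
pose V m (w : word n k m) : set (@crumpled_cube R n k B k_ge8) :=
  crumple B k_ge8 @` (cell k_ge8 w `&` light_at th m).
pose q := kR `^ (- be).
have q0 : 0 <= q by exact: powR_ge0.
have diam m (w : word n k m) : (diameter (V m w) <= (q ^+ m)%:E)%E.
  apply: diameter_le => _ _ [x [wx xm] <-] [y [wy _] <-].
  rewrite mdist_crumple; apply: le_trans (size_dist_le B k_ge8 (cell_close wx wy)) _.
  apply: le_trans (size_at_lightness _ _ _ _) _ => //.
  rewrite /light_factor -exprVn -exprM exprVn -powR_invn ?(ltW kR_gt0)//.
  rewrite -powR_mulrn// -powRrM ler_powR// mulNr lerN2 natrM -mulrA.
  by rewrite ler_wpM2l// mulrC.
have qk m : q ^+ m <= kR ^- m.
  rewrite -exprVn lerXn2r ?nnegrE ?invr_ge0 ?(ltW kR_gt0)//.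
  by rewrite -powR_inv1 ?(ltW kR_gt0)// ler_powR// lerN2.
apply: (@hausdorff_measure_limsup R _ p _ _ V 1 (fun m => 1 * kR ^- m)) => //.
- move=> _ [x hx <-] M; have [m Mm xm] := hx M; exists m => //.
  by exists (itinerary k_ge8 m x), x.
- by move=> m w; apply: le_trans (diam m w) _; rewrite lee_fin mul1r.
- exact: exprV_small.
move=> m; apply: (@sum_weight_le _ _ _ _ (fun=> (q ^+ m) `^ p)).
  by move=> w; apply: hausdorff_weight_le => //; [exact: ltW|exact: exprn_ge0].
rewrite sumr_const card_ffun card_ffun !card_ord -[leLHS]mulr_natl mul1r.
rewrite powR_exprn// /q -powRrM mulNr.
apply: (@le_trans _ _ ((kR ^+ n * kR ^- n.+1) ^+ m)).
  rewrite exprMn natrX natrX ler_wpM2l ?exprn_ge0 ?(ltW kR_gt0)//.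
  rewrite lerXn2r ?nnegrE ?powR_ge0 ?invr_ge0 ?exprn_ge0 ?(ltW kR_gt0)//.
  by rewrite -powR_invn ?(ltW kR_gt0)// ler_powR// lerN2.
rewrite exprSr invfM mulrA divff ?mul1r ?expf_neq0 ?gt_eqF//.
rewrite exprVn lef_pV2 ?posrE ?exprn_gt0// lerXn2r ?nnegrE ?(ltW kR_gt0)//.
by apply: le_trans kR_ge8; rewrite ler_nat.
Qed.

(** Off the set, all late generations fail [light_at], so the sets [V m] with large [m] cover. The
    exponential moment bounds their total weight by n^s times the [m]-th power of (4n+1) k^-(p/2),
    which is at most 1/2 by hypothesis. *)
Lemma hausdorff_setC_often_light (p : R) : (0 < n)%N -> 0 < p ->
  2 * (4 * n%:R + 1) <= kR `^ (p / 2) ->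
  hausdorff_measure (n%:R - 1 + p) (~` often_light (p / 2)) = 0.
Proof.
move=> n0 p0 kp; set th := p / 2; set s := n%:R - 1 + p.
have n1 : 1 <= n%:R :> R by rewrite ler1n.
have s0 : 0 <= s by rewrite /s; lra.
pose V m (w : word n k m) : set cube := cell k_ge8 w `&` ~` light_at th m.
have diam m (w : word n k m) : (diameter (V m w) <= (n%:R * kR ^- m)%:E)%E.
  apply: diameter_le => x y [wx _] [wy _].
  exact: close_mdist (cell_close wx wy).
have nk m : 0 <= n%:R * kR ^- m by rewrite mulr_ge0 ?invr_ge0 ?exprn_ge0 ?(ltW kR_gt0).
apply: (@hausdorff_measure_limsup R _ s _ _ V (n%:R `^ s)
  (fun m => n%:R * kR ^- m)) => //.
- move=> x /existsNP[M hM] M'; exists (maxn M M'); first exact: leq_maxr.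
  exists (itinerary k_ge8 (maxn M M') x); split=> // h; apply: hM.
  by exists (maxn M M') => //; exact: leq_maxl.
- exact: exprV_small.
(* A Markov bound: a nonempty [V m w] has word lightness at most th m, so the two extra factors
   multiply to at least 1. *)
move=> m; apply: (@sum_weight_le _ _ _ _ (fun w =>
    (n%:R * kR ^- m) `^ s * kR `^ (th * m%:R) * kR ^- word_lightness w)).
  move=> w; have [->|/set0P[x [wx xm]]] := eqVneq (V m w) set0.
    by rewrite hausdorff_weight0 lee_fin !mulr_ge0 ?powR_ge0.
  apply: le_trans (hausdorff_weight_le s0 (nk m) (diam m w)) _.
  rewrite lee_fin -mulrA ler_peMr ?powR_ge0//.
  rewrite -powR_invn ?(ltW kR_gt0)// -powRD ?(lt0r_neq0 kR_gt0) ?implybT//.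
  rewrite -[leLHS](powRr0 kR) ler_powR// subr_ge0.
  have /negP := xm; rewrite -ltNge => /ltW; apply: le_trans.
  by rewrite ler_nat -wx; exact: word_lightness_le.
rewrite -mulr_sumr.
have hw := @sum_word_weight R n k k_ge8 m n0.
apply: le_trans (ler_wpM2l _ hw) _.
  by rewrite mulr_ge0 ?powR_ge0.
rewrite powRM ?invr_ge0 ?exprn_ge0 ?(ltW kR_gt0)//.
have e1 : (kR ^- m) `^ s = (kR `^ (- s)) ^+ m.
  rewrite -exprVn powR_exprn ?invr_ge0 ?(ltW kR_gt0)//.
  by rewrite -[kR^-1]powR_inv1 ?(ltW kR_gt0)// -powRrM mulN1r.
have e2 : kR `^ (th * m%:R) = (kR `^ th) ^+ m.
  by rewrite powRrM powR_mulrn ?powR_ge0.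
rewrite e1 e2 -!(mulrA (n%:R `^ s)) ler_wpM2l ?powR_ge0//.
rewrite -!exprMn -exprVn.
rewrite lerXn2r ?nnegrE ?mulr_ge0 ?powR_ge0 ?exprn_ge0 ?addr_ge0 ?(ltW kR_gt0)//.
rewrite -powR_mulrn ?(ltW kR_gt0)//.
have kn0 : kR != 0 by rewrite gt_eqF.
have -> : kR `^ (- s) * kR `^ th * ((4 * n%:R + 1) * kR `^ n.-1%:R) =
    (4 * n%:R + 1) * kR `^ (- th).
  rewrite mulrCA; congr (_ * _).
  rewrite -!powRD ?kn0 ?implybT//; congr (_ `^ _).
  by rewrite -subn1 natrB// /s /th; lra.
rewrite powRN ler_pdivrMr ?powR_gt0//.
by rewrite ler_pdivlMl//.
Qed.

End ExceptionalSet.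

Theorem theorem1p4 (R : realType) (n : nat) (hn : (1 <= n)%N)
    (p : R) (hp : 0 < p) :
  exists (X : metricType R) (f : unit_cube R n -> X) (E : set (unit_cube R n)),
    [/\ quasisymmetric f,
        borel_set E,
        (hausdorff_dim (f @` E) <= p%:E)%E &
        (hausdorff_dim (~` E) <= (n%:R - 1 + p)%:E)%E].
Proof.
have n1 : 1 <= n%:R :> R by rewrite ler1n.
have natbound (c : R) : exists m : nat, c <= m%:R.
  by exists (Num.bound `|c|); apply: le_trans (ler_norm c) _; exact/ltW/archi_boundP.
(* The choice of [k] serves the complement of E, that of [B] below serves the image of E. *)
have [k k8 hk] : exists2 k : nat, (8 <= k)%N & 2 * (4 * n%:R + 1) <= k%:R `^ (p / 2).
  have [k0 hk0] := natbound ((2 * (4 * n%:R + 1)) `^ (p / 2)^-1).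
  exists (maxn 8 k0); first exact: leq_maxl.
  have c0 : 0 <= 2 * (4 * n%:R + 1) :> R by lra.
  have p2 : 0 < p / 2 by rewrite divr_gt0.
  have -> : 2 * (4 * n%:R + 1) = ((2 * (4 * n%:R + 1)) `^ (p / 2)^-1) `^ (p / 2) :> R.
    by rewrite -powRrM mulVf ?powRr1// lt0r_neq0.
  apply: ge0_ler_powR; rewrite ?nnegrE ?powR_ge0 ?(ltW p2)//.
  by apply: le_trans hk0 _; rewrite ler_nat leq_maxr.
(* The two terms encode (B+1)p/2 >= 1 and (B+1)(p/2)p >= n+1. *)
have [B hB] := natbound (Num.max (p / 2)^-1 (n.+1%:R / (p / 2 * p))).
have p2 : 0 < p / 2 by rewrite divr_gt0.
have hB1 : Num.max (p / 2)^-1 (n.+1%:R / (p / 2 * p)) <= B.+1%:R.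
  by apply: le_trans hB _; rewrite ler_nat.
rewrite ge_max in hB1; case/andP: hB1 => B1 B2.
exists (@crumpled_cube R n k B k8), (crumple B k8), (often_light k (p / 2)); split.
- exact: crumple_quasisymmetric.
- exact: often_light_borel.
- apply: hausdorff_dim_le; first exact: ltW.
  apply: hausdorff_crumple_often_light => //; first exact: ltW.
    by rewrite -ler_pdivrMr// div1r.
  by rewrite -mulrA -ler_pdivrMr// mulr_gt0.
- apply: hausdorff_dim_le; first lra.
  exact: hausdorff_setC_often_light.
Qed.
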